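(* Let $n\ge 1$ be an integer. For all $1<p<\infty$, $$\|C_{\mathcal{U}^n}\|_{L^p(b\mathcal{U}^n)\to H^p(\mathcal{U}^n)}\;\ge\;\|P_{\mathcal{U}^{n-1}}\|_{L^p(\mathcal{U}^{n-1})\to A^p(\mathcal{U}^{n-1})},$$ where $C_{\mathcal{U}^n}$ is the Cauchy–Szegő projection for $\mathcal{U}^n$ and $P_{\mathcal{U}^{n-1}}$ is the Bergman projection for $\mathcal{U}^{n-1}$.
   Context: For an integer $m\ge0$, write points of $\mathbb{C}^{m+1}$ as $z=(z',z_{m+1})$ with $z'=(z_1,\dots,z_m)\in\mathbb{C}^m$, $z_{m+1}\in\mathbb{C}$, and $z'\cdot\overline{w'}=\sum_{j=1}^m z_j\overline{w_j}$. The Siegel upper half-space is $\mathcal{U}^m=\{z\in\mathbb{C}^{m+1}:\operatorname{Im}z_{m+1}>|z'|^2\}$ (so $\mathcal{U}^0$ is the upper half-plane), with boundary $b\mathcal{U}^m$. Put $\boldsymbol{\rho}(z,w):=\frac{i}{2}(\overline{w}_{m+1}-z_{m+1})-z'\cdot\overline{w'}$ for points of $\mathbb{C}^{m+1}$. Bergman projection: $L^p(\mathcal{U}^m)$ is taken with respect to Lebesgue measure $dV$ on $\mathbb{C}^{m+1}$, $A^p(\mathcal{U}^m)$ is its closed subspace of holomorphic functions (with the $L^p$ norm), and $$(P_{\mathcal{U}^m}f)(z)=\frac{(m+1)!}{4\pi^{m+1}}\int_{\mathcal{U}^m}\boldsymbol{\rho}(z,w)^{-m-2}f(w)\,dV(w),$$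 which is bounded from $L^p(\mathcal{U}^m)$ to $A^p(\mathcal{U}^m)$ for $1<p<\infty$. Cauchy–Szegő projection: the measure $d\boldsymbol{\beta}$ on $b\mathcal{U}^m$ is defined by $\int_{b\mathcal{U}^m}f\,d\boldsymbol{\beta}=\int_{\mathbb{C}^m\times\mathbb{R}}f(z',t+i|z'|^2)\,dz'\,dt$ (Lebesgue measure), and $L^p(b\mathcal{U}^m)$ is taken with respect to it. With $\mathbf{i}=(0',i)\in\mathbb{C}^{m+1}$, $H^p(\mathcal{U}^m)$ consists of holomorphic $f$ on $\mathcal{U}^m$ with $\|f\|_{H^p}:=\sup_{t>0}\left\{\int_{b\mathcal{U}^m}|f(u+t\mathbf{i})|^p\,d\boldsymbol{\beta}(u)\right\}^{1/p}<\infty$. Then $$(C_{\mathcal{U}^m}f)(z)=\frac{m!}{4\pi^{m+1}}\int_{b\mathcal{U}^m}\boldsymbol{\rho}(z,u)^{-m-1}f(u)\,d\boldsymbol{\beta}(u),\qquad z\in\mathcal{U}^m,$$ which is bounded from $L^p(b\mathcal{U}^m)$ onto $H^p(\mathcal{U}^m)$ for $1<p<\infty$. The norms in the claim are operator norms between the indicated spaces. *)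

(* Defs.v *)
From HB Require Import structures.
From mathcomp Require Import all_boot all_order all_algebra.
From mathcomp Require Import complex.
From mathcomp Require Import all_classical all_reals all_analysis.

Set Implicit Arguments.
Unset Strict Implicit.
Unset Printing Implicit Defensive.

Import Order.TTheory GRing.Theory Num.Theory.
Import numFieldNormedType.Exports.
Import Normc.

Local Open Scope classical_set_scope.
Local Open Scope ring_scope.

(* Real coordinates (x, y) of x + iy in C, and the coordinates of a point of
   C^m; these are the measurable types on which Lebesgue measure lives. *)
Notation plane R := (measurableTypeR R * measurableTypeR R)%type.
Notation mplane R m := (m.-tuple (plane R)).

(* The library's sigma-finite structure on [m1 \x m2] is not found by
   canonical inference, hence this explicit statement. *)
Lemma sigma_finite_product d1 d2 (T1 : measurableType d1)
    (T2 : measurableType d2) (R : realType)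
    (m1 : {sigma_finite_measure set T1 -> \bar R})
    (m2 : {sigma_finite_measure set T2 -> \bar R}) :
  sigma_finite setT (m1 \x m2)%E.
Proof.
have /sigma_finiteP[F [TF ndF Foo]] := sigma_finiteT m1.
have /sigma_finiteP[G [TG ndG Goo]] := sigma_finiteT m2.
exists (fun n => F n `*` G n).
  rewrite -setXTT TF TG predeqE => -[x y]; split.
    move=> [/= [n _ Fnx] [k _ Gky]]; exists (maxn n k) => //; split.
    - by move: x Fnx; exact/subsetPset/ndF/leq_maxl.
    - by move: y Gky; exact/subsetPset/ndG/leq_maxr.
  by move=> [n _ []/= ? ?]; split; exists n.
move=> k; have [? ?] := Foo k; have [? ?] := Goo k.
split; first exact: measurableX.
by rewrite product_measure1E// lte_mul_pinfty// ge0_fin_numE.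
Qed.

Section lebesgue_measure_Cm.
Context {R : realType}.

Definition lebesgue_C : set (plane R) -> \bar R :=
  (@lebesgue_measure R \x @lebesgue_measure R)%E.

HB.instance Definition _ := Measure.on lebesgue_C.
HB.instance Definition _ := Measure_isSigmaFinite.Build _ _ _ lebesgue_C
  (sigma_finite_product lebesgue_measure lebesgue_measure).

Definition pcons m (x : plane R * mplane R m) : mplane R m.+1 :=
  [tuple of x.1 :: x.2].

Definition puncons m (x : mplane R m.+1) : plane R * mplane R m :=
  (thead x, [tuple of behead x]).

Lemma pconsK m : cancel (@pcons m) (@puncons m).
Proof.
by case=> x t; rewrite /pcons /puncons theadE; congr pair; exact: val_inj.
Qed.

Lemma measurable_pcons m : measurable_fun setT (@pcons m).
Proof. exact: measurable_cons. Qed.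

Lemma measurable_puncons m : measurable_fun setT (@puncons m).
Proof.
apply: measurable_fun_pair; last exact: measurable_behead.
exact: measurable_tnth.
Qed.

Section step.
Variables (m : nat) (mu : {sigma_finite_measure set (mplane R m) -> \bar R}).

Definition lebesgue_step : set (mplane R m.+1) -> \bar R :=
  pushforward (lebesgue_C \x mu)%E (@pcons m).

Let lebesgue_step0 : lebesgue_step set0 = 0%E.
Proof. by rewrite /lebesgue_step /pushforward preimage_set0 measure0. Qed.

Let lebesgue_step_ge0 A : (0 <= lebesgue_step A)%E.
Proof. exact: (measure_ge0 (lebesgue_C \x mu)%E). Qed.

Let lebesgue_step_sigma_additive : semi_sigma_additive lebesgue_step.
Proof.
have mpre A : measurable A -> measurable (@pcons m @^-1` A).
  by move=> mA; rewrite -[X in measurable X]setTI; exact: measurable_pcons.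
move=> F mF tF mUF; rewrite /lebesgue_step /pushforward preimage_bigcup.
apply: (@measure_semi_sigma_additive _ _ _ (lebesgue_C \x mu)%E).
- by move=> n; exact: mpre.
- apply/trivIsetP => /= i j _ _ ij; rewrite -preimage_setI.
  by move/trivIsetP : tF => /(_ _ _ _ _ ij) ->//; rewrite preimage_set0.
- by rewrite -preimage_bigcup; exact: mpre.
Qed.

HB.instance Definition _ := isMeasure.Build _ _ _ lebesgue_step
  lebesgue_step0 lebesgue_step_ge0 lebesgue_step_sigma_additive.

Let lebesgue_step_sigma_finite : sigma_finite setT lebesgue_step.
Proof.
have [F FT mF] := sigma_finite_product lebesgue_C mu.
exists (fun i => @puncons m @^-1` F i).
  by rewrite -preimage_bigcup -FT preimage_setT.
move=> i; have [mFi Fi] := mF i; split.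
  by rewrite -[X in measurable X]setTI; exact: measurable_puncons.
rewrite /lebesgue_step /pushforward -comp_preimage.
by rewrite (_ : _ \o _ = id) ?preimage_id//; apply/funext => x; exact: pconsK.
Qed.

HB.instance Definition _ := Measure_isSigmaFinite.Build _ _ _ lebesgue_step
  lebesgue_step_sigma_finite.

End step.

(* Lebesgue measure on C^m; on the one-point space C^0 it is the point mass. *)
Fixpoint lebesgue_Cm m : {sigma_finite_measure set (mplane R m) -> \bar R} :=
  if m is k.+1 then lebesgue_step (lebesgue_Cm k) else dirac [tuple].

End lebesgue_measure_Cm.

(* R[i] bundled as a [numClosedFieldType], which makes it a normed module over
   itself: differentiability below is complex differentiability. *)
Definition Cplx (R : realType) : numClosedFieldType := R[i].

(* C^{m+1}, with points z = (z', z_{m+1}). *)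
Notation Cpt R m := ('rV[Cplx R]_m * Cplx R)%type.

Section siegel.
Context {R : realType}.
Local Notation C := (Cplx R).

Definition toC (x : plane R) : C := (x.1 +i* x.2)%C.

Definition toCm m (x : mplane R m) : 'rV[C]_m := \row_j toC (tnth x j).

Definition sqnorm m (z : 'rV[C]_m) : R := \sum_j normc (z 0 j) ^+ 2.

Definition hdot m (z w : 'rV[C]_m) : C := \sum_j z 0 j * (w 0 j)^*%C.

Definition siegel m : set (Cpt R m) :=
  [set z | sqnorm z.1 < complex.Im z.2].
Arguments siegel m : clear implicits.

Definition rho m (z w : Cpt R m) : C :=
  ('i%C / 2) * (w.2^*%C - z.2) - hdot z.1 w.1.

Definition holomorphic_on m (U : set (Cpt R m)) (f : Cpt R m -> C) :=
  forall z, U z -> differentiable f z.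

Section complex_valued.
Context d (T : measurableType d) (mu : {measure set T -> \bar R}).

Definition measurable_C (D : set T) (f : T -> C) :=
  measurable_fun D (fun x => complex.Re (f x)) /\
  measurable_fun D (fun x => complex.Im (f x)).

Definition integral_C (D : set T) (f : T -> C) : C :=
  ((\int[mu]_(x in D) complex.Re (f x)) +i*
   (\int[mu]_(x in D) complex.Im (f x)))%C.

Definition Lp_norm (D : set T) (p : R) (f : T -> C) : \bar R :=
  'N[mu]_p%:E[ (fun x => (normc (f x))%:E) \_ D ]%E.

(* Functions, not classes modulo null sets; measurability is with respect to
   the Borel sigma-algebra, which loses no class. *)
Definition Lp_space (D : set T) (p : R) : set (T -> C) :=
  [set f : T -> C | measurable_C D f /\ (Lp_norm D p f < +oo)%E].

End complex_valued.

(* dV, in the real coordinates of (z', z_{m+1}); [vol_pt] is the point with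
   given coordinates. *)
Definition volume m : {measure set (mplane R m * plane R) -> \bar R} :=
  (lebesgue_Cm m \x lebesgue_C)%E.

Definition vol_pt m (x : mplane R m * plane R) : Cpt R m :=
  (toCm x.1, toC x.2).

Definition vol_siegel m : set (mplane R m * plane R) :=
  @vol_pt m @^-1` siegel m.
Arguments vol_siegel m : clear implicits.

(* dbeta, in the coordinates (z', t) of the boundary point
   (z', t + i |z'|^2). *)
Definition beta m : {measure set (mplane R m * measurableTypeR R) -> \bar R} :=
  (lebesgue_Cm m \x @lebesgue_measure R)%E.

Definition bdry_pt m (x : mplane R m * measurableTypeR R) : Cpt R m :=
  (toCm x.1, (x.2 +i* sqnorm (toCm x.1))%C).

(* Functions on the Siegel half-space, or on its boundary, are represented by
   functions on C^{m+1} of which only the values on that set matter. *)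

Definition norm_LpU m p (f : Cpt R m -> C) : \bar R :=
  Lp_norm (volume m) (vol_siegel m) p (f \o @vol_pt m).

Definition LpU m p : set (Cpt R m -> C) :=
  [set f : Cpt R m -> C |
    Lp_space (volume m) (vol_siegel m) p (f \o @vol_pt m)].

Definition Ap m p : set (Cpt R m -> C) :=
  [set f : Cpt R m -> C | LpU p f /\ holomorphic_on (siegel m) f].

Definition bergman m (f : Cpt R m -> C) (z : Cpt R m) : C :=
  ((m.+1)`!%:R / (4 * pi ^+ m.+1))%:C%C *
  integral_C (volume m) (vol_siegel m)
    (fun x => rho z (vol_pt x) ^- m.+2 * f (vol_pt x)).

Definition norm_LpbU m p (f : Cpt R m -> C) : \bar R :=
  Lp_norm (beta m) setT p (f \o @bdry_pt m).

Definition LpbU m p : set (Cpt R m -> C) :=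
  [set f : Cpt R m -> C | Lp_space (beta m) setT p (f \o @bdry_pt m)].

Definition ibold m : Cpt R m := (0, 'i%C).

Definition norm_Hp m p (f : Cpt R m -> C) : \bar R :=
  ereal_sup [set norm_LpbU p (fun u => f (u + t%:C%C *: ibold m))
            | t in [set t : R | 0 < t]].

Definition Hp m p : set (Cpt R m -> C) :=
  [set f : Cpt R m -> C |
    holomorphic_on (siegel m) f /\ (norm_Hp p f < +oo)%E].

Definition szego m (f : Cpt R m -> C) (z : Cpt R m) : C :=
  (m`!%:R / (4 * pi ^+ m.+1))%:C%C *
  integral_C (beta m) setT
    (fun x => rho z (bdry_pt x) ^- m.+1 * f (bdry_pt x)).

(* The least M >= 0 such that T maps X into Y with |T f|_Y <= M |f|_X; it is
   +oo exactly when T is not bounded from X to Y. *)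
Definition op_norm (V W : Type) (X : set V) (nX : V -> \bar R)
    (Y : set W) (nY : W -> \bar R) (T : V -> W) : \bar R :=
  ereal_inf [set M%:E | M in [set M : R | 0 <= M /\
    forall f, X f -> Y (T f) /\ (nY (T f) <= M%:E * nX f)%E]].

End siegel.

Arguments siegel {R} m _.
Arguments vol_siegel {R} m _.
Arguments LpU {R} m p _.
Arguments Ap {R} m p _.
Arguments bergman {R} m f z.
Arguments LpbU {R} m p _.
Arguments Hp {R} m p _.
Arguments szego {R} m f z.

(* Main.v *)
From HB Require Import structures.
Require Import Defs.
From mathcomp Require Import all_boot all_order all_algebra.
From mathcomp Require Import complex ring lra.
From mathcomp Require Import all_classical all_reals all_analysis.
From mathcomp Require Import measurable_realfun.

(** Write [n = m + 1] and single out the first coordinate [a] of a point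
    [(a, z', z_(m+2))] of [C^(m+2)]. Forgetting [a] maps the boundary of [U^n]
    onto [{Im z_(m+2) >= |z'|^2}]: a boundary point satisfies
    [Im z_(m+2) = |z'|^2 + |a|^2], so the fibre over a point of [U^m] is a
    circle in the [a]-plane. Since Lebesgue measure of the plane is sent by
    [a |-> |a|^2] to [pi] times Lebesgue measure of the half-line
    ([ge0_integral_sqmod]), this map pushes [dbeta] to [pi dV]
    ([ge0_integral_drop_bdry]). Hence for [g] in [L^p(U^m)] the function
    [f(a, z', z_(m+2)) = g(z', z_(m+2))] has
    [|f|_(L^p(bU^n)) = pi^(1/p) |g|_(L^p(U^m))] ([norm_bdry_lift]).

    At a point with [a = 0] the Szego kernel of [U^n] does not see the first
    coordinate of the boundary point and is the Bergman kernel of [U^m] up to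
    the normalising constants, whose quotient is the same factor [pi]. So
    [C f (0, z) = P g (z)] ([szego_embed0]).

    Moreover [f], and hence [C f], is invariant under rotations of [a]
    ([szego_rotation]), and [C f] is holomorphic as a member of [H^p]. A
    holomorphic function of one variable which is constant on circles has zero
    derivative in the tangential directions, so it is constant
    ([rotation_invariant_cst]); therefore [C f (a, z) = P g (z)] wherever
    [(a, z)] lies in [U^n] ([szego_embed]). Pushing forward once more, the
    [L^p] norm of [C f (. + t i)] is at least [pi^(1/p)] times the one of
    [P g (. + t i)], and Fatou's lemma for [t -> 0] yields
    [pi^(1/p) |P g| <= |C f|_(H^p)]. A bound [|C f|_(H^p) <= M |f|] thus gives
    [|P g| <= M |g|], which is [norm_bergman_le].

    The same identity makes [P g] holomorphic. Integrals of complex functions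
    are transported through the positive and negative parts of their real and
    imaginary parts, where Tonelli's theorem applies.

    Rotations are handled without trigonometry: they are parametrised
    rationally by the tangent [a] of half the angle, and are products of three
    shears, which preserve Lebesgue measure by Tonelli's theorem and
    translation invariance on the line. *)

Set Implicit Arguments.
Unset Strict Implicit.
Unset Printing Implicit Defensive.

Import Order.TTheory GRing.Theory Num.Theory.
Import numFieldNormedType.Exports.
Import Normc.

Local Open Scope classical_set_scope.
Local Open Scope ring_scope.

(** * Changes of variables on the line *)

Section change_of_variables.
Context d1 d2 (X : measurableType d1) (Y : measurableType d2) (R : realType).
Variables (mu : {measure set X -> \bar R}) (nu : {measure set Y -> \bar R}).
Variables (phi : X -> Y) (D : set Y).
Hypotheses (mphi : measurable_fun setT phi) (mD : measurable D).
Hypothesis munu :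
  forall A, measurable A -> A `<=` D -> mu (phi @^-1` A) = nu A.

(** Only the part of [nu] inside [D] has to be an image of [mu], as for
    [|z|^2], whose values lie in a half-line. *)
Lemma ge0_integral_change (f : Y -> \bar R) :
  measurable_fun D f -> (forall y, D y -> 0 <= f y)%E ->
  (\int[mu]_(x in phi @^-1` D) f (phi x) = \int[nu]_(y in D) f y)%E.
Proof.
move=> mf f0; rewrite -[LHS](ge0_integral_pushforward mphi)//; last first.
  by move=> y /set_mem; exact: f0.
by apply: eq_measure_integral => A mA AD; exact: munu.
Qed.
End change_of_variables.

Section lebesgue_line.
Context {R : realType}.
Local Notation mu := (@lebesgue_measure R).

Lemma measurable_shift (a : R) :
  measurable_fun setT (+%R a : measurableTypeR R -> measurableTypeR R).
Proof. exact: measurable_funD. Qed.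

Lemma measurable_mull (a : R) :
  measurable_fun setT ( *%R a : measurableTypeR R -> measurableTypeR R).
Proof. exact: measurable_funM. Qed.

Lemma lebesgue_measure_shift (a : R) (A : set R) : measurable A ->
  mu ((+%R a : measurableTypeR R -> measurableTypeR R) @^-1` A) = mu A.
Proof.
move=> mA.
have mphi := measurable_shift a.
rewrite -[LHS]/(pushforward mu (+%R a : _ -> measurableTypeR R) A).
apply/esym/lebesgue_measure_unique => //= _ [[b c]] _ <-.
rewrite /pushforward.
have -> : +%R a @^-1` `]b, c]%classic = `]b - a, c - a]%classic.
  by apply/seteqP; split => x; rewrite /= !in_itv/= ltrBlDl lerBrDl.
rewrite !lebesgue_measure_itv/= !lte_fin ltrD2r.
by case: ifP => // _; rewrite -!EFinB; congr EFin; ring.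
Qed.

Lemma lebesgue_measure_scale (k : R) (A : set R) : 0 < k -> measurable A ->
  mu (( *%R k : measurableTypeR R -> measurableTypeR R) @^-1` A) =
  (k^-1%:E * mu A)%E.
Proof.
move=> k0 mA.
have mphi := measurable_mull k.
suff muA : mu A = mscale (NngNum (ltW k0))
    (pushforward mu ( *%R k : _ -> measurableTypeR R)) A.
  by rewrite (muA mphi) /mscale/= muleA -EFinM mulVf ?gt_eqF// mul1e.
move=> m; apply: lebesgue_measure_unique mA => /= _ [[b c]] _ <-.
rewrite /mscale/= /pushforward.
have -> : *%R k @^-1` `]b, c]%classic = `]b / k, c / k]%classic.
  apply/seteqP; split => x; rewrite /= !in_itv/=;
    by rewrite ltr_pdivrMr// ler_pdivlMr// mulrC.
rewrite !lebesgue_measure_itv/= !lte_fin ltr_pM2r ?invr_gt0//.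
case: ifP => // _; rewrite ?mule0// -!EFinB -EFinM; congr EFin.
by field; rewrite gt_eqF.
Qed.

Lemma ge0_integral_shift (a : R) (f : measurableTypeR R -> \bar R) :
  measurable_fun setT f -> (forall x, 0 <= f x)%E ->
  (\int[mu]_x f (a + x)%R = \int[mu]_x f x)%E.
Proof.
move=> mf f0; apply: (@ge0_integral_change _ _ _ _ _ mu mu (+%R a) setT) => //.
  exact: measurable_shift.
by move=> A mA _; exact: lebesgue_measure_shift.
Qed.

Lemma ge0_integral_scale (k : R) (f : measurableTypeR R -> \bar R) : 0 < k ->
  measurable_fun setT f -> (forall x, 0 <= f x)%E ->
  (\int[mu]_x f (k * x)%R = k^-1%:E * \int[mu]_x f x)%E.
Proof.
move=> k0 mf f0.
have k1 : 0 <= k^-1 by rewrite invr_ge0 ltW.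
rewrite -[RHS](@ge0_integral_mscale _ _ _ _ _ _ (NngNum k1))//.
apply: (@ge0_integral_change _ _ _ _ _ mu (mscale (NngNum k1) mu)
  ( *%R k) setT) => //.
by move=> A mA _; exact: lebesgue_measure_scale.
Qed.
End lebesgue_line.

(** * Shears, rotations and discs in the plane *)

Section lebesgue_plane.
Context {R : realType}.
Local Notation mu := (@lebesgue_measure R).
Local Notation P := (plane R).

Lemma ge0_integral_planeE (f : P -> \bar R) :
  measurable_fun setT f -> (forall x, 0 <= f x)%E ->
  (\int[lebesgue_C]_z f z = \int[mu]_x \int[mu]_y f (x, y))%E.
Proof.
move=> mf f0; have := @fubini_tonelli1 _ _ _ _ _ mu mu f mf f0.
exact: etrans.
Qed.

Lemma ge0_integral_plane_swap (f : P -> \bar R) :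
  measurable_fun setT f -> (forall x, 0 <= f x)%E ->
  (\int[lebesgue_C]_z f z = \int[mu]_y \int[mu]_x f (x, y))%E.
Proof.
move=> mf f0; have := @fubini_tonelli2 _ _ _ _ _ mu mu f mf f0.
exact: etrans.
Qed.

Definition shear1 (a : R) (z : P) : P := (a * z.2 + z.1, z.2).
Definition shear2 (a : R) (z : P) : P := (z.1, a * z.1 + z.2).

Lemma measurable_shear1 a : measurable_fun setT (shear1 a).
Proof.
apply: measurable_fun_pair => //=; apply: measurable_funD => //.
exact: measurable_funM.
Qed.

Lemma measurable_shear2 a : measurable_fun setT (shear2 a).
Proof.
apply: measurable_fun_pair => //=; apply: measurable_funD => //.
exact: measurable_funM.
Qed.

(** On each horizontal line a shear is a translation. *)
Lemma ge0_integral_shear1 a (f : P -> \bar R) :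
  measurable_fun setT f -> (forall x, 0 <= f x)%E ->
  (\int[lebesgue_C]_z f (shear1 a z) = \int[lebesgue_C]_z f z)%E.
Proof.
move=> mf f0; have mfs := measurableT_comp mf (@measurable_shear1 a).
rewrite (ge0_integral_plane_swap mfs (fun=> f0 _)).
rewrite (ge0_integral_plane_swap mf f0).
apply: eq_integral => y _.
apply: (ge0_integral_shift (a * y)
  (f := fun x : measurableTypeR R => f (x, y))) => //.
exact: measurableT_comp.
Qed.

Lemma ge0_integral_shear2 a (f : P -> \bar R) :
  measurable_fun setT f -> (forall x, 0 <= f x)%E ->
  (\int[lebesgue_C]_z f (shear2 a z) = \int[lebesgue_C]_z f z)%E.
Proof.
move=> mf f0; have mfs := measurableT_comp mf (@measurable_shear2 a).
rewrite (ge0_integral_planeE mfs (fun=> f0 _)) (ge0_integral_planeE mf f0).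
apply: eq_integral => x _.
apply: (ge0_integral_shift (a * x)
  (f := fun y : measurableTypeR R => f (x, y))) => //.
exact: measurableT_comp.
Qed.

(** The rotation whose half-angle has tangent [a]; every angle but a half turn
    is of this form. *)
Definition rotation (a : R) (z : P) : P :=
  let c := (1 - a ^+ 2) / (1 + a ^+ 2) in let s := 2 * a / (1 + a ^+ 2) in
  (c * z.1 - s * z.2, s * z.1 + c * z.2).

(** The classical factorisation of a rotation into three shears, which reduces
    its invariance to that of Lebesgue measure on the line. *)
Lemma rotationE a :
  rotation a = shear1 (- a) \o shear2 (2 * a / (1 + a ^+ 2)) \o shear1 (- a).
Proof.
have a0 : 1 + a ^+ 2 != 0 by rewrite gt_eqF// ltr_wpDr// sqr_ge0.
apply/funext => -[x y]; rewrite /rotation /shear1 /shear2/=.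
by congr pair; field.
Qed.

Lemma measurable_rotation a : measurable_fun setT (rotation a).
Proof.
rewrite rotationE; apply: measurableT_comp => //; last exact: measurable_shear1.
apply: measurableT_comp => //; first exact: measurable_shear1.
exact: measurable_shear2.
Qed.

Lemma ge0_integral_rotation a (f : P -> \bar R) :
  measurable_fun setT f -> (forall x, 0 <= f x)%E ->
  (\int[lebesgue_C]_z f (rotation a z) = \int[lebesgue_C]_z f z)%E.
Proof.
move=> mf f0; rewrite rotationE/=.
have m1 := @measurable_shear1; have m2 := @measurable_shear2.
rewrite (@ge0_integral_shear1 _
  (f \o shear1 (- a) \o shear2 (2 * a / (1 + a ^+ 2))))//=.
  rewrite (@ge0_integral_shear2 _ (f \o shear1 (-a)))//=.
    by rewrite ge0_integral_shear1.
  exact: measurableT_comp.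
by apply: measurableT_comp => //; exact: measurableT_comp.
Qed.

Lemma ge0_integral_plane_scale k (f : P -> \bar R) : 0 < k ->
  measurable_fun setT f -> (forall x, 0 <= f x)%E ->
  (\int[lebesgue_C]_z f (k * z.1, k * z.2)%R =
   (k ^- 2)%:E * \int[lebesgue_C]_z f z)%E.
Proof.
move=> k0 mf f0.
have mk := @measurable_mull R k.
rewrite !ge0_integral_planeE//; last first.
  apply: measurableT_comp => //.
  by apply: measurable_fun_pair => //=; exact: measurable_funM.
under eq_integral => x _.
  rewrite (@ge0_integral_scale _ k (fun y => f (k * x, y)%R) k0)//; last first.
    exact: measurableT_comp.
  over.
have mF : measurable_fun setT
    (fun x : measurableTypeR R => \int[mu]_y f (x, y))%E.
  exact: (@measurable_fun_fubini_tonelli_F _ _ _ _ _ mu f mf).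
have F0 x : (0 <= \int[mu]_y f (x, y))%E by exact: integral_ge0.
have k1 : (0 <= (k^-1)%:E)%E by rewrite lee_fin invr_ge0 ltW.
rewrite (ge0_integralZl mu measurableT (measurableT_comp mF mk)
  (fun x _ => F0 (k * x)) k1).
rewrite (@ge0_integral_scale _ k (fun x => \int[mu]_y f (x, y))%E k0)//.
by rewrite muleA -EFinM -invfM -expr2.
Qed.

Definition sqmod (z : P) : measurableTypeR R := z.1 ^+ 2 + z.2 ^+ 2.

Lemma measurable_sqmod : measurable_fun setT sqmod.
Proof. by apply: measurable_funD; apply: measurable_funX. Qed.

Lemma measurable_disc (r : R) : measurable (sqmod @^-1` `]-oo, r[%classic).
Proof. by rewrite -[X in measurable X]setTI; exact: measurable_sqmod. Qed.

Lemma sqmod_ge0 z : 0 <= sqmod z.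
Proof. by rewrite addr_ge0// sqr_ge0. Qed.

Lemma sqmod_rotation a z : sqmod (rotation a z) = sqmod z :> R.
Proof.
rewrite /sqmod /rotation/=; field.
by rewrite gt_eqF// ltr_wpDr// sqr_ge0.
Qed.

(** Homogeneity only: the area of the unit disc is left unevaluated here and is
    found in [c_pi]. *)
Lemma lebesgue_C_disc (r : R) :
  lebesgue_C (sqmod @^-1` `]-oo, r[%classic) =
  ((Num.max r 0)%:E * lebesgue_C (sqmod @^-1` `]-oo, 1%R[%classic))%E.
Proof.
have [r0|r0] := leP r 0.
  rewrite (_ : _ @^-1` _ = set0) ?measure0 ?mul0e//.
  apply/seteqP; split => z //=; rewrite in_itv/= ltNge (le_trans r0)//.
  exact: sqmod_ge0.
have s0 : 0 < (Num.sqrt r)^-1 by rewrite invr_gt0 sqrtr_gt0.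
rewrite -(setIT (sqmod @^-1` `]-oo, r[%classic)).
rewrite -(setIT (sqmod @^-1` `]-oo, 1%R[%classic)).
rewrite -(integral_indic lebesgue_C measurableT (measurable_disc r)).
rewrite -(integral_indic lebesgue_C measurableT (measurable_disc 1)).
have := @ge0_integral_plane_scale _
  (fun z => (\1_(sqmod @^-1` `]-oo, 1%R[%classic) z)%:E) s0.
rewrite exprVn invrK sqr_sqrtr ?(ltW r0)// => <-//; last first.
  by apply/measurable_EFinP; apply: measurable_indic; exact: measurable_disc.
apply: eq_integral => z _; rewrite !indicE; congr (_ %:R%:E).
congr nat_of_bool; apply/idP/idP; rewrite !inE/= !in_itv/= /sqmod/=;
  by rewrite !exprMn -mulrDr exprVn sqr_sqrtr ?(ltW r0)// mulrC ltr_pdivrMr ?mul1r.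
Qed.

Lemma lebesgue_C_unit_disc_fin :
  (lebesgue_C (sqmod @^-1` `]-oo, 1%R[%classic) < +oo)%E.
Proof.
apply: (@le_lt_trans _ _ (lebesgue_C (`[-1, 1]%classic `*` `[-1, 1]%classic))).
  apply: le_measure; rewrite ?inE.
  - exact: measurable_disc.
  - by apply: measurableX => //.
  - move=> [x y]; rewrite /= !in_itv/= /sqmod/= => xy1.
    have x0 := sqr_ge0 x; have y0 := sqr_ge0 y.
    by split; apply/andP; split; nra.
rewrite /lebesgue_C product_measure1E//= !lebesgue_measure_itv/= lte_fin.
by case: ifP => // _; rewrite -?EFinB -?EFinM ?ltry ?mule0.
Qed.

Let c := fine (lebesgue_C (sqmod @^-1` `]-oo, 1%R[%classic)).

Let c_ge0 : 0 <= c. Proof. exact: fine_ge0. Qed.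

(** Open half-lines ending at [r] form a pi-system generating the Borel sets, and
    both measures are known on them. *)
Let pushforward_sqmod (A : set (measurableTypeR R)) : measurable A ->
  A `<=` `[0%R, +oo[%classic ->
  lebesgue_C (sqmod @^-1` A) = mscale (NngNum c_ge0) mu A.
Proof.
move=> mA A0.
have m0 : measurable (`[0%R, +oo[%classic : set (measurableTypeR R)) by [].
have -> : mscale (NngNum c_ge0) mu A = mscale (NngNum c_ge0) (mrestr mu m0) A.
  by congr (_ * _)%E; rewrite -[in LHS](setIidl A0).
pose nu : {measure set (measurableTypeR R) -> \bar R} :=
  measure_function_pushforward__canonical__measure_function_Measure
    lebesgue_C measurable_sqmod.
pose cmu0 : {measure set (measurableTypeR R) -> \bar R} :=
  mscale (NngNum c_ge0) (mrestr mu m0).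
transitivity (cmu0 A); last by [].
transitivity (nu A); first by [].
apply: (@measure_unique _ R (measurableTypeR R) (@RGenInftyO.G R)
  (fun k => `]-oo, k%:R[%classic) _ _ _ _ nu cmu0) => //.
- exact: RGenInftyO.measurableE.
- move=> _ _ [x ->] [y ->]; exists (Num.min x y).
  by apply/seteqP; split => z /=; rewrite !in_itv/= lt_min => /andP.
- by move=> k; exists k%:R.
- apply/seteqP; split => // x _.
  exists (Num.bound `|x|) => //=; rewrite in_itv/=.
  exact: le_lt_trans (ler_norm x) (archi_boundP (normr_ge0 x)).
- move=> _ [x ->].
  rewrite /nu /cmu0/= /pushforward lebesgue_C_disc /mscale/= /mrestr.
  rewrite muleC fineK ?ge0_fin_numE ?lebesgue_C_unit_disc_fin//; congr (_ * _)%E.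
  have -> : `]-oo, x[%classic `&` `[0%R, +oo[%classic = `[0, x[%classic.
    by apply/seteqP; split => z /=; rewrite !in_itv/= andbT andbC => /andP.
  rewrite lebesgue_measure_itv/= lte_fin; have [x0|x0] := ltP 0 x.
    by rewrite oppr0 adde0.
  by [].
- move=> k; rewrite /nu/= /pushforward lebesgue_C_disc lte_mul_pinfty//.
  exact: lebesgue_C_unit_disc_fin.
Qed.

Let ge0_integral_sqmodc (f : measurableTypeR R -> \bar R) :
  measurable_fun setT f -> (forall x, 0 <= f x)%E ->
  (\int[lebesgue_C]_z f (sqmod z) = c%:E * \int[mu]_(x in `[0%R, +oo[) f x)%E.
Proof.
move=> mf f0.
have mI : measurable (`[0, +oo[%classic : set (measurableTypeR R)) by [].
have mfI := @measurable_funTS _ _ _ _ _ f mf.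
rewrite -[RHS](@ge0_integral_mscale _ _ _ _ _ mI (NngNum c_ge0))//.
transitivity (\int[lebesgue_C]_(z in sqmod @^-1` `[0%R, +oo[) f (sqmod z))%E.
  by congr integral; apply/seteqP; split => z //= _; rewrite in_itv/= sqmod_ge0.
by apply: ge0_integral_change => //; exact: measurable_sqmod.
Qed.

(** Integrating [exp (- |z|^2)] over the plane gives [c] through its radial
    profile and the square of the Gaussian integral through its product form. *)
Let c_pi : c = pi.
Proof.
have mE : measurable_fun setT (fun x : measurableTypeR R => (expR (- x))%:E).
  by apply/measurable_EFinP; apply: measurableT_comp.
have mG : measurable_fun setT (fun x : measurableTypeR R => (gauss_fun x)%:E).
  by apply/measurable_EFinP; exact: measurable_gauss_fun.
have := @ge0_integral_sqmodc (fun x => (expR (- x))%:E).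
have -> : (\int[mu]_(x in `[0%R, +oo[) (expR (- x))%:E = 1)%E.
  rewrite -(@integral_exponential_pdf R 1)// integral_mkcond.
  apply: eq_integral => x _; rewrite /exponential_pdf !patchE.
  by case: ifP => // _; rewrite mulN1r mul1r.
rewrite mule1 => /(_ mE (fun x => expR_ge0 _)).
have ex (z : P) :
    ((expR (- sqmod z))%:E = (gauss_fun z.1)%:E * (gauss_fun z.2)%:E)%E.
  by rewrite -EFinM /gauss_fun -expRD -opprD.
under eq_integral do rewrite ex.
rewrite ge0_integral_planeE/=; last 2 first.
- by apply: emeasurable_funM; exact: (measurableT_comp mG).
- by move=> z; rewrite mule_ge0// lee_fin gauss_fun_ge0.
have g0 (x : R) : (0 <= (gauss_fun x)%:E)%E by rewrite lee_fin gauss_fun_ge0.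
under eq_integral => x _.
  rewrite (ge0_integralZl mu measurableT mG (fun y _ => g0 y) (g0 x)).
  over.
under eq_integral do rewrite muleC.
rewrite (ge0_integralZl mu measurableT mG (fun y _ => g0 y)); last first.
  exact: integral_ge0.
rewrite integralT_gauss -EFinM -expr2 sqr_sqrtr ?pi_ge0//.
by case=> ->.
Qed.

(** Polar coordinates for radial functions. *)
Lemma ge0_integral_sqmod (f : measurableTypeR R -> \bar R) :
  measurable_fun setT f -> (forall x, 0 <= f x)%E ->
  (\int[lebesgue_C]_z f (sqmod z) = pi%:E * \int[mu]_(x in `[0%R, +oo[) f x)%E.
Proof. by rewrite -c_pi; exact: ge0_integral_sqmodc. Qed.

End lebesgue_plane.

(** * Integration over the boundary of the Siegel half-space *)

Section beta_integrals.
Context {R : realType}.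
Local Notation mu := (@lebesgue_measure R).

Lemma ge0_integral_CmS m (F : mplane R m.+1 -> \bar R) :
  measurable_fun setT F -> (forall x, 0 <= F x)%E ->
  (\int[lebesgue_Cm m.+1]_x F x =
   \int[lebesgue_C \x lebesgue_Cm m]_x F (pcons x))%E.
Proof.
move=> mF F0; apply/esym.
apply: (@ge0_integral_change _ _ _ _ _ (lebesgue_C \x lebesgue_Cm m)%E
  (lebesgue_Cm m.+1) (@pcons R m) setT) => //.
exact: measurable_pcons.
Qed.

(** The first coordinate is integrated innermost, since both its rotation and its
    replacement by [|z|^2] act with the other coordinates fixed. *)
Lemma ge0_integral_betaS m (F : mplane R m.+1 * measurableTypeR R -> \bar R) :
  measurable_fun setT F -> (forall x, 0 <= F x)%E ->
  (\int[beta m.+1]_x F x =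
   \int[lebesgue_Cm m]_w \int[mu]_t \int[lebesgue_C]_z F (pcons (z, w), t))%E.
Proof.
move=> mF F0.
have H1 := @fubini_tonelli1 _ _ _ _ _ (lebesgue_Cm m.+1) mu F mF F0.
have mF1 := @measurable_fun_fubini_tonelli_F _ _ _ _ _ mu F mF F0.
have F10 x : (0 <= fubini_F mu F x)%E by exact: integral_ge0.
transitivity (\int[lebesgue_Cm m.+1]_x fubini_F mu F x)%E; first exact: H1.
rewrite (ge0_integral_CmS mF1 F10).
have mF2 := measurableT_comp mF1 (@measurable_pcons R m).
rewrite (@fubini_tonelli2 _ _ _ _ _ lebesgue_C (lebesgue_Cm m) _ mF2
  (fun=> F10 _)).
apply: eq_integral => w _; rewrite /fubini_G /fubini_F.
pose H (x : plane R * measurableTypeR R) := F (pcons (x.1, w), x.2).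
have mH : measurable_fun setT H.
  apply: measurableT_comp => //; apply: measurable_fun_pair => //=.
  apply: measurableT_comp; first exact: measurable_pcons.
  exact: measurable_fun_pair.
have H0 x : (0 <= H x)%E by exact: F0.
have := @fubini_tonelli _ _ _ _ _ lebesgue_C mu H mH H0.
by [].
Qed.

Lemma punconsK m : cancel (@puncons R m) (@pcons R m).
Proof. by move=> t; rewrite [RHS]tuple_eta; exact: val_inj. Qed.

Lemma bdry_coords m (x : mplane R m.+1 * measurableTypeR R) :
  exists z w t, x = (pcons (z, w), t).
Proof.
case: x => x t; exists (puncons x).1, (puncons x).2, t.
by rewrite -surjective_pairing punconsK.
Qed.

(** The rotation of the first coordinate, an automorphism of the boundary. *)
Definition rot_bdry m (a : R) (x : mplane R m.+1 * measurableTypeR R) :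
    mplane R m.+1 * measurableTypeR R :=
  (pcons (rotation a (puncons x.1).1, (puncons x.1).2), x.2).

Lemma measurable_rot_bdry m a : measurable_fun setT (@rot_bdry m a).
Proof.
have mp : measurable_fun setT
    (fun x : mplane R m.+1 * measurableTypeR R => puncons x.1).
  by apply: measurableT_comp => //; exact: measurable_puncons.
have m1 := measurableT_comp (@measurable_rotation R a)
  (measurableT_comp measurable_fst mp).
have m2 := measurableT_comp measurable_snd mp.
have m3 := measurableT_comp (@measurable_pcons R m) (measurable_fun_pair m1 m2).
exact: measurable_fun_pair m3 measurable_snd.
Qed.

Lemma rot_bdryE m a z (w : mplane R m) t :
  rot_bdry a (pcons (z, w), t) = (pcons (rotation a z, w), t).
Proof. by rewrite /rot_bdry pconsK. Qed.

Lemma ge0_integral_rot_bdry m a (F : mplane R m.+1 * measurableTypeR R -> \bar R) :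
  measurable_fun setT F -> (forall x, 0 <= F x)%E ->
  (\int[beta m.+1]_x F (rot_bdry a x) = \int[beta m.+1]_x F x)%E.
Proof.
move=> mF F0.
have mFr := measurableT_comp mF (@measurable_rot_bdry m a).
rewrite (ge0_integral_betaS mF F0) (ge0_integral_betaS mFr (fun=> F0 _)).
apply: eq_integral => w _; apply: eq_integral => t _.
pose H z := F (pcons (z, w), t).
have mH : measurable_fun setT H.
  apply: measurableT_comp => //; apply: measurable_fun_pair => //=.
  apply: measurableT_comp; first exact: measurable_pcons.
  exact: measurable_fun_pair.
rewrite -(@ge0_integral_rotation _ a H mH (fun=> F0 _)).
by apply: eq_integral => z _; rewrite [LHS]/comp rot_bdryE.
Qed.

Lemma sqnormE m (w : mplane R m) :
  sqnorm (toCm w) = \sum_(j < m) sqmod (tnth w j).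
Proof.
apply: eq_bigr => j _; rewrite mxE/= sqr_sqrtr//; exact: sqmod_ge0.
Qed.

Lemma measurable_sqnorm m : measurable_fun setT
  (fun w : mplane R m => sqnorm (toCm w) : measurableTypeR R).
Proof.
under eq_fun do rewrite sqnormE.
apply: measurable_sum => j.
apply: measurableT_comp; first exact: measurable_sqmod.
exact: measurable_tnth.
Qed.

(** In coordinates, the map forgetting the first coordinate of a boundary point;
    the height [sqnorm] is kept, so a point off [z = 0] lands strictly inside the
    lower half-space. *)
Definition drop_bdry m (x : mplane R m.+1 * measurableTypeR R) :
    mplane R m * plane R :=
  ((puncons x.1).2, (x.2, sqnorm (toCm x.1))).

Lemma measurable_drop_bdry m : measurable_fun setT (@drop_bdry m).
Proof.
have mp : measurable_fun setT
    (fun x : mplane R m.+1 * measurableTypeR R => puncons x.1).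
  by apply: measurableT_comp => //; exact: measurable_puncons.
have ms : measurable_fun setT
    (fun x : mplane R m.+1 * measurableTypeR R =>
       sqnorm (toCm x.1) : measurableTypeR R).
  exact: (measurableT_comp (@measurable_sqnorm m.+1)).
have m1 := measurableT_comp measurable_snd mp.
have m2 := measurable_fun_pair measurable_snd ms.
exact: measurable_fun_pair m1 m2.
Qed.

Lemma sqnorm_pcons m z (w : mplane R m) :
  sqnorm (toCm (pcons (z, w))) = sqmod z + sqnorm (toCm w).
Proof.
rewrite !sqnormE big_ord_recl; congr (_ + _).
by apply: eq_bigr => i _; rewrite tnthS.
Qed.

Lemma drop_bdryE m z (w : mplane R m) t :
  drop_bdry (pcons (z, w), t) = (w, (t, sqmod z + sqnorm (toCm w))).
Proof. by rewrite /drop_bdry pconsK sqnorm_pcons. Qed.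

(** The push-forward of [dbeta] is [pi dV]: with [w] and [t] fixed, the height
    [|z|^2 + |w|^2] of the image is distributed as [pi] times Lebesgue measure on
    the half-line above [|w|^2]. *)
Lemma ge0_integral_drop_bdry m (G : mplane R m * plane R -> \bar R) :
  measurable_fun setT G -> (forall x, 0 <= G x)%E ->
  (forall x, ~ vol_siegel m x -> G x = 0%E) ->
  (\int[beta m.+1]_x G (drop_bdry x) = pi%:E * \int[volume m]_x G x)%E.
Proof.
move=> mG G0 GD.
have mGd := measurableT_comp mG (@measurable_drop_bdry m).
rewrite (ge0_integral_betaS mGd (fun=> G0 _)).
have H1 := @fubini_tonelli1 _ _ _ _ _ (lebesgue_Cm m) lebesgue_C G mG G0.
have mG1 := @measurable_fun_fubini_tonelli_F _ _ _ _ _ lebesgue_C G mG G0.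
have G10 x : (0 <= fubini_F lebesgue_C G x)%E by exact: integral_ge0.
have p0 : (0 <= pi%:E :> \bar R)%E by rewrite lee_fin pi_ge0.
transitivity (pi%:E * \int[lebesgue_Cm m]_x fubini_F lebesgue_C G x)%E; last first.
  by congr (_ * _)%E; apply: esym; exact: H1.
rewrite -(ge0_integralZl (lebesgue_Cm m) measurableT mG1 (fun x _ => G10 x) p0).
apply: eq_integral => w _; rewrite /fubini_F.
pose H v := G (w, v).
have mH : measurable_fun setT H by exact: measurableT_comp.
have H0 v : (0 <= H v)%E by exact: G0.
rewrite (ge0_integral_planeE mH H0).
have mH1 := @measurable_fun_fubini_tonelli_F _ _ _ _ _ mu H mH H0.
have H10 x : (0 <= fubini_F mu H x)%E by exact: integral_ge0.
rewrite -(ge0_integralZl mu measurableT mH1 (fun x _ => H10 x) p0).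
apply: eq_integral => t _; rewrite /fubini_F.
pose s0 := sqnorm (toCm w).
pose h (s : measurableTypeR R) := H (t, s).
have mh : measurable_fun setT h by exact: measurableT_comp.
have h0 s : (0 <= h s)%E by exact: G0.
have mhs : measurable_fun setT (fun s : measurableTypeR R => h (s0 + s)%R).
  by apply: measurableT_comp => //; exact: measurable_shift.
(* Measure the height from the boundary point above [w]. *)
rewrite -[X in (_ * X)%E](ge0_integral_shift s0 mh h0).
transitivity (\int[lebesgue_C]_z h (s0 + sqmod z)%R)%E.
  by apply: eq_integral => z _; rewrite [LHS]/comp drop_bdryE addrC.
rewrite (@ge0_integral_sqmod _ _ mhs (fun=> h0 _)).
congr (_ * _)%E; rewrite integral_mkcond; apply: eq_integral => s _.
rewrite patchE; case: ifPn => //; rewrite notin_setE/= in_itv/= andbT => sl0.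
apply/esym/GD; rewrite /vol_siegel/siegel/= -/s0.
by rewrite ltrDl => /ltW.
Qed.

End beta_integrals.

(** * Measurability and change of variables for complex functions *)

(** Enough for complex inverses, where only squared moduli are inverted. *)
Lemma measurable_invr_ge0 d (T : measurableType d) (R : realType) (f : T -> R) :
  (forall x, 0 <= f x) -> measurable_fun setT f ->
  measurable_fun setT (fun x => (f x)^-1).
Proof.
move=> f0 mf; rewrite (_ : (fun x => (f x)^-1) = (fun x => f x `^ (-1))).
  exact: (measurableT_comp (@measurable_powR R (-1)) mf).
by apply/funext => x; rewrite powR_inv1.
Qed.

Section measurable_complex.
Context d (T : measurableType d) (R : realType).
Implicit Types f g : T -> Cplx R.

Lemma measurable_CD f g : measurable_C setT f -> measurable_C setT g ->
  measurable_C setT (fun x => f x + g x).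
Proof.
move=> [f1 f2] [g1 g2]; split.
  rewrite (_ : (fun x => _) = (fun x => complex.Re (f x) + complex.Re (g x))).
    exact: measurable_funD.
  by apply/funext => x; case: (f x) (g x) => [a b] [c e].
rewrite (_ : (fun x => _) = (fun x => complex.Im (f x) + complex.Im (g x))).
  exact: measurable_funD.
by apply/funext => x; case: (f x) (g x) => [a b] [c e].
Qed.

Lemma measurable_CN f : measurable_C setT f -> measurable_C setT (fun x => - f x).
Proof.
move=> [f1 f2]; split.
  rewrite (_ : (fun x => _) = (fun x => - complex.Re (f x))).
    exact: measurable_funN.
  by apply/funext => x; case: (f x) => [a b].
rewrite (_ : (fun x => _) = (fun x => - complex.Im (f x))).
  exact: measurable_funN.
by apply/funext => x; case: (f x) => [a b].
Qed.

Lemma measurable_CJ f : measurable_C setT f ->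
  measurable_C setT (fun x => (f x)^*%C).
Proof.
move=> [f1 f2]; split.
  rewrite (_ : (fun x => _) = (fun x => complex.Re (f x)))//.
  by apply/funext => x; case: (f x) => [a b].
rewrite (_ : (fun x => _) = (fun x => - complex.Im (f x))).
  exact: measurable_funN.
by apply/funext => x; case: (f x) => [a b].
Qed.

Lemma measurable_CM f g : measurable_C setT f -> measurable_C setT g ->
  measurable_C setT (fun x => f x * g x).
Proof.
move=> [f1 f2] [g1 g2]; split.
  rewrite (_ : (fun x => _) = (fun x => complex.Re (f x) * complex.Re (g x) -
      complex.Im (f x) * complex.Im (g x))).
    by apply: measurable_funB; exact: measurable_funM.
  by apply/funext => x; case: (f x) (g x) => [a b] [c e].
rewrite (_ : (fun x => _) = (fun x => complex.Re (f x) * complex.Im (g x) +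
    complex.Im (f x) * complex.Re (g x))).
  by apply: measurable_funD; exact: measurable_funM.
by apply/funext => x; case: (f x) (g x) => [a b] [c e].
Qed.

Lemma measurable_CV f : measurable_C setT f ->
  measurable_C setT (fun x => (f x)^-1).
Proof.
move=> [f1 f2].
have mn : measurable_fun setT
    (fun x => (complex.Re (f x) ^+ 2 + complex.Im (f x) ^+ 2)^-1).
  apply: measurable_invr_ge0; first by move=> x; rewrite addr_ge0// sqr_ge0.
  by apply: measurable_funD; exact: measurable_funX.
split.
  rewrite (_ : (fun x => _) = (fun x => complex.Re (f x) *
      (complex.Re (f x) ^+ 2 + complex.Im (f x) ^+ 2)^-1)).
    exact: measurable_funM.
  by apply/funext => x; case: (f x) => [a b].
rewrite (_ : (fun x => _) = (fun x => - (complex.Im (f x) *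
    (complex.Re (f x) ^+ 2 + complex.Im (f x) ^+ 2)^-1))).
  by apply: measurable_funN; exact: measurable_funM.
by apply/funext => x; case: (f x) => [a b].
Qed.

Lemma measurable_C_cst (c : Cplx R) : measurable_C setT (fun _ : T => c).
Proof. by split; exact: measurable_cst. Qed.

Lemma measurable_CX f n : measurable_C setT f ->
  measurable_C setT (fun x => f x ^+ n).
Proof.
move=> mf; elim: n => [|n ih]; first exact: measurable_C_cst.
rewrite (_ : (fun x => _) = (fun x => f x * f x ^+ n)); first exact: measurable_CM.
by apply/funext => x; rewrite exprS.
Qed.

Lemma measurable_C_sum (I : Type) (s : seq I) (F : I -> T -> Cplx R) :
  (forall i, measurable_C setT (F i)) ->
  measurable_C setT (fun x => \sum_(i <- s) F i x).
Proof.
move=> mF; elim: s => [|i s ih].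
  rewrite (_ : (fun x => _) = (fun=> 0)); first exact: measurable_C_cst.
  by apply/funext => x; rewrite big_nil.
rewrite (_ : (fun x => _) = (fun x => F i x + \sum_(j <- s) F j x)).
  exact: measurable_CD.
by apply/funext => x; rewrite big_cons.
Qed.

Lemma measurable_normc f : measurable_C setT f ->
  measurable_fun setT (fun x => normc (f x)).
Proof.
move=> [f1 f2].
rewrite (_ : (fun x => _) =
    (fun x => (complex.Re (f x) ^+ 2 + complex.Im (f x) ^+ 2) `^ (2^-1))).
  apply: (measurableT_comp (@measurable_powR R _)).
  by apply: measurable_funD; exact: measurable_funX.
apply/funext => x; case: (f x) => [a b] /=.
by rewrite -powR12_sqrt// addr_ge0// sqr_ge0.
Qed.

Lemma measurable_C_toC (f : T -> plane R) : measurable_fun setT f ->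
  measurable_C setT (fun x => toC (f x)).
Proof. by move=> mf; split; exact: (measurableT_comp _ mf). Qed.

End measurable_complex.

Lemma measurable_C_comp d d' (T : measurableType d) (U : measurableType d')
    (R : realType) (phi : T -> U) (f : U -> Cplx R) :
  measurable_fun setT phi -> measurable_C setT f ->
  measurable_C setT (fun x => f (phi x)).
Proof. move=> mphi [f1 f2].
by split; [exact: (measurableT_comp f1 mphi)|exact: (measurableT_comp f2 mphi)].
Qed.

Lemma measurable_C_restrict d (T : measurableType d) (R : realType)
    (D : set T) (f : T -> Cplx R) : measurable D ->
  measurable_C D f -> measurable_C setT (f \_ D).
Proof.
move=> mD [f1 f2]; split.
  rewrite (_ : (fun x => _) = (fun x => complex.Re (f x)) \_ D).
    exact/(measurable_restrictT _ mD).
  by apply/funext => x; rewrite !patchE; case: ifP.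
rewrite (_ : (fun x => _) = (fun x => complex.Im (f x)) \_ D).
  exact/(measurable_restrictT _ mD).
by apply/funext => x; rewrite !patchE; case: ifP.
Qed.

Lemma measurable_C_funTS d (T : measurableType d) (R : realType) (D : set T)
    (f : T -> Cplx R) : measurable_C setT f -> measurable_C D f.
Proof. by move=> [f1 f2]; split; exact: measurable_funTS. Qed.

(** Stated along measurable maps so as to cover both the joint kernel and its
    sections, on the half-space as well as on its boundary. *)
Lemma measurable_C_rho d (T : measurableType d) (R : realType) m
    (a b : T -> mplane R m * plane R) :
  measurable_fun setT a -> measurable_fun setT b ->
  measurable_C setT (fun x => rho (vol_pt (a x)) (vol_pt (b x))).
Proof.
move=> ma mb; rewrite /rho.
have m2 (c : T -> mplane R m * plane R) : measurable_fun setT c ->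
    measurable_C setT (fun x => (vol_pt (c x)).2).
  by move=> mc; apply: measurable_C_toC; exact: measurableT_comp.
apply: measurable_CD; last apply: measurable_CN.
  apply: measurable_CM; first exact: measurable_C_cst.
  by apply: measurable_CD; [apply: measurable_CJ|apply: measurable_CN]; exact: m2.
have m1 j (c : T -> mplane R m * plane R) : measurable_fun setT c ->
    measurable_C setT (fun x => (vol_pt (c x)).1 0 j).
  move=> mc.
  rewrite (_ : (fun x => _) = (fun x => toC (tnth (c x).1 j))).
    apply: measurable_C_toC.
    exact: (measurableT_comp (@measurable_tnth _ _ _ j)
      (measurableT_comp measurable_fst mc)).
  by apply/funext => x; rewrite mxE.
rewrite /hdot; apply: measurable_C_sum => j.
by apply: measurable_CM; [exact: m1|apply: measurable_CJ; exact: m1].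
Qed.

Section integral_complex.
Local Open Scope ereal_scope.

Let scale_subl (R : realType) (c : R) (x y : \bar R) :
  (0 < c)%R -> 0 <= x -> 0 <= y ->
  c%:E * x - c%:E * y = c%:E * (x - y).
Proof.
move=> c0; case: x => [x| |]; case: y => [y| |] //= x0 y0.
- by rewrite -?EFinM -?EFinD -?EFinM mulrBr.
- by rewrite gt0_muley ?lte_fin//= gt0_muleNy ?lte_fin.
- by rewrite gt0_muley ?lte_fin//= gt0_muley ?lte_fin.
- by rewrite gt0_muley ?lte_fin//= gt0_muleNy ?lte_fin.
Qed.

Let fine_scale (R : realType) (c : R) (x : \bar R) : (0 < c)%R ->
  fine (c%:E * x) = (c * fine x)%R.
Proof.
move=> c0; case: x => [x| |] //=; rewrite mulr0.
  by rewrite gt0_muley ?lte_fin.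
by rewrite gt0_muleNy ?lte_fin.
Qed.

Context d1 d2 (X : measurableType d1) (Y : measurableType d2) (R : realType).
Variables (mu : {measure set X -> \bar R}) (nu : {measure set Y -> \bar R}).
Variables (phi : X -> Y) (c : R) (D : set Y).
Hypothesis c0 : (0 < c)%R.
Hypothesis munu : forall F : Y -> \bar R, measurable_fun setT F ->
  (forall y, 0 <= F y) -> (forall y, ~ D y -> F y = 0) ->
  \int[mu]_x F (phi x) = c%:E * \int[nu]_y F y.

(** Positive and negative parts are transported separately; as [c > 0], scaling
    commutes with their difference even where it is infinite or indeterminate. *)
Lemma integral_C_change (k : Y -> Cplx R) : measurable_C setT k ->
  (forall y, ~ D y -> k y = 0%R) ->
  integral_C mu setT (fun x => k (phi x)) = (c%:C%C * integral_C nu setT k)%R.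
Proof.
move=> [k1 k2] k0.
have key (f : Y -> R) : measurable_fun setT f -> (forall y, ~ D y -> f y = 0%R) ->
    (\int[mu]_x f (phi x) = c * \int[nu]_y f y)%R.
  move=> mf f0; rewrite /Rintegral.
  have mE : measurable_fun setT (EFin \o f) by exact/measurable_EFinP.
  have fp : \int[mu]_x (fun x => (f (phi x))%:E)^\+ x =
      c%:E * \int[nu]_y (EFin \o f)^\+ y.
    rewrite -munu => [||//|y Dy]; last by rewrite funeposE/= f0// maxxx.
    - by apply: eq_integral => x _; rewrite !funeposE.
    - exact: measurable_funepos.
  have fn : \int[mu]_x (fun x => (f (phi x))%:E)^\- x =
      c%:E * \int[nu]_y (EFin \o f)^\- y.
    rewrite -munu => [||//|y Dy]; last by rewrite funenegE/= f0// oppr0 maxxx.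
    - by apply: eq_integral => x _; rewrite !funenegE.
    - exact: measurable_funeneg.
  rewrite integralE [in RHS]integralE fp fn.
  rewrite scale_subl//;
    try by apply: integral_ge0 => y _; rewrite ?funepos_ge0 ?funeneg_ge0.
  exact: fine_scale.
rewrite /integral_C (key (fun y => complex.Re (k y)) k1) => [|y /k0 ->//].
rewrite (key (fun y => complex.Im (k y)) k2) => [|y /k0 ->//].
by apply/eqP; rewrite eq_complex/= !mul0r subr0 addr0 !eqxx.
Qed.
End integral_complex.

Lemma integral_C_mkcond d (T : measurableType d) (R : realType)
    (mu : {measure set T -> \bar R}) (D : set T) (f : T -> Cplx R) :
  integral_C mu D f = integral_C mu setT (f \_ D).
Proof.
rewrite /integral_C /Rintegral; congr (fine _ +i* fine _)%C;
  rewrite integral_mkcond; apply: eq_integral => x _; rewrite !patchE;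
  by case: ifP.
Qed.

Section measurable_integral.
Context d1 d2 (X : measurableType d1) (Y : measurableType d2) (R : realType).
Variable (nu : {sigma_finite_measure set Y -> \bar R}).

Lemma measurable_C_integral (k : X * Y -> Cplx R) : measurable_C setT k ->
  measurable_C setT (fun x => integral_C nu setT (fun y => k (x, y))).
Proof.
have key (f : X * Y -> R) : measurable_fun setT f ->
    measurable_fun setT (fun x => \int[nu]_y f (x, y)).
  move=> mf; rewrite /Rintegral.
  apply: (measurableT_comp (fine_measurable measurableT)).
  have mE : measurable_fun setT (EFin \o f) by exact/measurable_EFinP.
  rewrite (_ : (fun x => _) = (fun x => (\int[nu]_y (EFin \o f)^\+ (x, y) -
      \int[nu]_y (EFin \o f)^\- (x, y))%E)); last first.
    apply/funext => x; rewrite integralE; congr (_ - _)%E.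
      by apply: eq_integral => y _; rewrite !funeposE.
    by apply: eq_integral => y _; rewrite !funenegE.
  apply: emeasurable_funB.
    exact: (@measurable_fun_fubini_tonelli_F _ _ _ _ _ nu _ (measurable_funepos mE)).
  exact: (@measurable_fun_fubini_tonelli_F _ _ _ _ _ nu _ (measurable_funeneg mE)).
by move=> [k1 k2]; split; [exact: (key _ k1)|exact: (key _ k2)].
Qed.
End measurable_integral.

(** Tonelli's theorem requires sigma-finiteness of the product measure, which
    comes from its two factors. *)
Lemma measurable_C_integral_volume d (X : measurableType d) (R : realType) m
    (k : X * (mplane R m * plane R) -> Cplx R) : measurable_C setT k ->
  measurable_C setT (fun x => integral_C (volume m) setT (fun y => k (x, y))).
Proof.
have sf := sigma_finite_product (lebesgue_Cm m) (@lebesgue_C R).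
pose nu : {sigma_finite_measure set (mplane R m * plane R)%type -> \bar R} :=
  HB.pack (lebesgue_Cm m \x lebesgue_C)%E
   (Measure_isSigmaFinite.Build _ _ _ (lebesgue_Cm m \x lebesgue_C)%E sf).
exact: (@measurable_C_integral _ _ _ _ _ nu).
Qed.

(** * Holomorphic functions of one variable invariant under rotations *)

Section complex_limits.
Context {R : realType}.
Local Notation C := (Cplx R).

Lemma normc_ge0 (x : C) : 0 <= normc x.
Proof. by case: x => a b; exact: sqrtr_ge0. Qed.

Lemma normc_gt0 (x : C) : x != 0 -> 0 < normc x.
Proof.
move=> x0; rewrite lt_neqAle; apply/andP; split; last exact: normc_ge0.
by apply: contra x0 => /eqP/esym/eq0_normc ->.
Qed.

Lemma normc_dist (x y : C) : `|normc x - normc y| <= normc (x - y).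
Proof.
rewrite ler_distlC; apply/andP; split.
  have := le_normcD (x - y) y; rewrite subrK => xy.
  by rewrite lerBlDl.
have := le_normcD (y - x) x; rewrite subrK -(normcN (y - x)) opprB => yx.
by rewrite addrC.
Qed.

Lemma posC_real (e : C) : 0 < e -> exists2 r : R, 0 < r & e = r%:C%C.
Proof. by case: e => a b; rewrite ltcE/= => /andP[/eqP -> a0]; exists a. Qed.

Lemma ltC_norm (x : C) (r : R) : (`|x| < r%:C%C) = (normc x < r).
Proof. by rewrite -ltcR. Qed.

Lemma cvgC_normcP T (F : set_system T) (FF : Filter F) (f : T -> C) (l : C) :
  f @ F --> l <-> forall e : R, 0 < e -> \forall x \near F, normc (l - f x) < e.
Proof.
split=> [/cvgrPdist_lt fl e e0|fl].
  have := fl e%:C%C; rewrite ltcR => /(_ e0).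
  by apply: filterS => x; rewrite ltC_norm.
apply/cvgrPdist_lt => _ /posC_real[e e0 ->].
by move: (fl e e0); apply: filterS => x; rewrite ltC_norm.
Qed.

(** A way to probe a punctured complex limit along a real one-parameter family. *)
Lemma cvg_dnbhs0C (f : R -> C) (K : R) :
  (forall s, s != 0 -> f s != 0) -> (forall s, normc (f s) <= K * `|s|) ->
  f s @[s --> 0^'] --> (0 : C)^'.
Proof.
move=> f0 fK P; rewrite /dnbhs /within/= => /nbhs_ballP[_ /posC_real[e e0 ->]] eP.
have K1 : 0 < `|K| + 1 by rewrite ltr_wpDl.
apply/nbhs_ballP; exists (e / (`|K| + 1)) => /=; first by rewrite divr_gt0.
move=> s; rewrite /ball/= sub0r normrN => se s0; apply: eP; last exact: f0.
rewrite /ball/= sub0r normrN ltC_norm (le_lt_trans (fK s))//.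
rewrite (le_lt_trans (ler_wpM2r _ (ler_norm K)))//.
rewrite (@le_lt_trans _ _ ((`|K| + 1) * `|s|))//.
  by rewrite ler_wpM2r// lerDl.
by rewrite mulrC -ltr_pdivlMr.
Qed.

Lemma cvg_Re T (F : set_system T) (FF : Filter F) (f : T -> C) (l : C) :
  f @ F --> l -> complex.Re (f x) @[x --> F] --> complex.Re l.
Proof.
move=> /cvgC_normcP fl; apply/cvgrPdist_lt => e e0; move: (fl e e0).
apply: filterS => x; apply: le_lt_trans.
case: l (f x) {fl} => [a b] [c d] /=.
by rewrite -sqrtr_sqr ler_sqrt ?lerDl ?sqr_ge0// addr_ge0// sqr_ge0.
Qed.

Lemma cvg_Im T (F : set_system T) (FF : Filter F) (f : T -> C) (l : C) :
  f @ F --> l -> complex.Im (f x) @[x --> F] --> complex.Im l.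
Proof.
move=> /cvgC_normcP fl; apply/cvgrPdist_lt => e e0; move: (fl e e0).
apply: filterS => x; apply: le_lt_trans.
case: l (f x) {fl} => [a b] [c d] /=.
by rewrite -sqrtr_sqr ler_sqrt ?lerDr ?sqr_ge0// addr_ge0// sqr_ge0.
Qed.

(** The unimodular number [(1 + i a) / (1 - i a)] by which [rotation a]
    multiplies. *)
Definition unit_rotation (a : R) : C :=
  (((1 - a ^+ 2) / (1 + a ^+ 2)) +i* (2 * a / (1 + a ^+ 2)))%C.

Lemma toC_rotation a z : toC (rotation a z) = unit_rotation a * toC z.
Proof. by apply/eqP; rewrite eq_complex/= eqxx/= addrC. Qed.

Lemma unit_rotationB1 a :
  unit_rotation a - 1 = (2 * a)%:C%C * ('i%C * (1 -i* a)%C^-1).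
Proof.
have a0 : 1 + a ^+ 2 != 0 by rewrite gt_eqF// ltr_wpDr// sqr_ge0.
have -> : (1 -i* a)%C^-1 = ((1 / (1 + a ^+ 2)) +i* (a / (1 + a ^+ 2)))%C :> C.
  rewrite -[LHS]/((1 / (1 ^+ 2 + (- a) ^+ 2)) -i* (- a / (1 ^+ 2 + (- a) ^+ 2)))%C.
  by rewrite expr1n sqrrN mulNr opprK.
by apply/eqP; rewrite eq_complex/=; apply/andP; split; apply/eqP; field.
Qed.

Lemma unit_rotation_unitary a :
  unit_rotation a * (unit_rotation a)^*%C = 1 :> C.
Proof.
have a0 : 1 + a ^+ 2 != 0 by rewrite gt_eqF// ltr_wpDr// sqr_ge0.
by apply/eqP; rewrite eq_complex/=; apply/andP; split; apply/eqP; field.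
Qed.

Lemma normc_unit_rotationB1 a : normc (unit_rotation a - 1) <= 2 * `|a|.
Proof.
rewrite unit_rotationB1 !normcM normcV.
rewrite (_ : normc (2 * a)%:C%C = 2 * `|a|); last first.
  by rewrite /= expr0n/= addr0 sqrtr_sqr normrM ger0_norm.
rewrite (_ : normc 'i%C = 1); last by rewrite /= expr0n/= add0r expr1n sqrtr1.
rewrite mul1r ler_piMr// invf_le1.
  by rewrite /= -[leLHS]sqrtr1 ler_sqrt ?expr1n ?lerDl ?sqr_ge0// addr_ge0// sqr_ge0.
by rewrite /= sqrtr_gt0 expr1n ltr_wpDr// sqr_ge0.
Qed.

Lemma unit_rotation_neq1 a : a != 0 -> unit_rotation a - 1 != 0.
Proof.
move=> a0; rewrite unit_rotationB1 !mulf_neq0// ?invr_eq0.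
- by rewrite eq_complex/= negb_and mulf_neq0.
- by rewrite eq_complex/= negb_and oner_eq0 orbT.
- by rewrite eq_complex/= negb_and oner_eq0.
Qed.

Section rotation_invariant.
Variables (f : C -> C) (r : R).
Hypothesis df : forall z : C, normc z ^+ 2 < r -> derivable f z 1.
Hypothesis rf : forall a z, f (unit_rotation a * z) = f z.

(** Approach [z] along its circle, [h = (unit_rotation a - 1) z] with [a -> 0]:
    there the difference quotient vanishes. *)
Let derive_eq0 (z : C) : normc z ^+ 2 < r -> z != 0 ->
  (fun h : C => h^-1 *: (f (h *: 1 + z) - f z)) @ (0 : C)^' --> (0 : C).
Proof.
move=> zr z0; have /cvg_ex[/= D qD] := df zr.
suff D0 : D = 0 by rewrite D0 in qD.
have fK : (unit_rotation a - 1) * z @[a --> (0 : R)^'] --> (0 : C)^'.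
  apply: (@cvg_dnbhs0C _ (2 * normc z)) => a.
    by move=> a0; rewrite mulf_neq0// unit_rotation_neq1.
  by rewrite normcM mulrAC ler_wpM2r ?normc_unit_rotationB1// ltW// normc_gt0.
have := cvg_comp _ _ fK qD.
rewrite (_ : _ \o _ = cst 0); last first.
  apply/funext => a /=.
  by rewrite /GRing.scale/= mulr1 mulrBl mul1r subrK rf subrr mulr0.
move=> /cvgC_normcP D0; apply/eqP; apply: contraT => /normc_gt0 /D0.
by move=> /filter_ex[a /=]; rewrite subr0 ltxx.
Qed.

Let radial_cvg (z : C) (s : R) :
  s != 0 -> normc (s%:C%C * z) ^+ 2 < r -> z != 0 ->
  h^-1%:C%C * (f ((h + s)%:C%C * z) - f (s%:C%C * z)) @[h --> (0 : R)^'] -->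
  (0 : C).
Proof.
move=> s0 sr z0.
have sz0 : s%:C%C * z != 0 by rewrite mulf_neq0// eq_complex/= negb_and s0.
have q0 := derive_eq0 sr sz0.
have hK : h%:C%C * z @[h --> (0 : R)^'] --> (0 : C)^'.
  apply: (@cvg_dnbhs0C _ (normc z)) => h.
    by move=> h0; rewrite mulf_neq0// eq_complex/= negb_and h0.
  by rewrite normcM mulrC /= expr0n/= addr0 sqrtr_sqr.
have := cvg_comp _ _ hK q0.
move=> /(cvgM (cvg_cst z)); rewrite mulr0; apply: cvg_trans.
apply: near_eq_cvg; near=> h.
have h0 : h != 0 by near: h; exact: nbhs_dnbhs_neq.
rewrite /= /GRing.scale/= mulr1 -mulrDl -rmorphD/= invfM mulrA.
rewrite [X in X * _](_ : _ = (h^-1)%:C%C)//.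
by rewrite mulrCA divff// mulr1 fmorphV.
Unshelve. all: by end_near.
Qed.

(** The mean value theorem for the real and imaginary parts along the segment
    from [0] to [z]. At the endpoint [0], where tangential increments say nothing,
    continuity is enough. *)
Lemma rotation_invariant_cst (z : C) : normc z ^+ 2 < r -> f z = f 0.
Proof.
move=> zr; have [->//|z0] := eqVneq z 0.
have szr (s : R) : 0 <= s <= 1 -> normc (s%:C%C * z) ^+ 2 < r.
  move=> /andP[s0 s1]; apply: le_lt_trans zr.
  rewrite normcM exprMn ler_piMl ?sqr_ge0//= expr0n/= addr0 sqrtr_sqr.
  by rewrite expr_le1// ger0_norm.
pose g (s : R) := f (s%:C%C * z).
have cg (s : R) : 0 <= s <= 1 -> g x @[x --> s] --> g s.
  move=> s01.
  have /derivable1_diffP/differentiable_continuous fc := df (szr s s01).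
  have cz : (fun x : R => x%:C%C * z : C) @ s --> (s%:C%C * z : C).
    apply/cvgC_normcP => e e0; near=> x.
    rewrite -mulrBl -rmorphB normcM/= expr0n/= addr0 sqrtr_sqr.
    rewrite -ltr_pdivlMr ?normc_gt0//.
    near: x; apply: (@cvgr_dist_lt _ _ _ (nbhs s) _ id) => //.
    by rewrite divr_gt0// normc_gt0.
  exact: (cvg_comp _ _ cz fc).
have key (p : C -> R) :
    (forall T (F : set_system T) (FF : Filter F) (f : T -> C) (l : C),
      f @ F --> l -> p (f x) @[x --> F] --> p l) ->
    (forall (x y : C) (c : R), p (c%:C%C * (x - y)) = c * (p x - p y)) ->
    p (f z) = p (f 0).
  move=> pc pl.
  have p0 : p 0 = 0 by have := pl 0 0 0; rewrite subrr mulr0 mul0r.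
  have [] := @MVT R (p \o g) (fun=> 0) 0 1 ltr01.
  - move=> s; rewrite in_itv/= => /andP[s0 s1].
    have s01 : 0 <= s <= 1 by rewrite !ltW.
    have /pc := radial_cvg (lt0r_neq0 s0) (szr s s01) z0.
    rewrite p0 => c0.
    have c1 : h^-1 *: ((p \o g) (h *: 1 + s) - (p \o g) s) @[h --> 0^'] --> 0.
      apply: cvg_trans c0; apply: near_eq_cvg; near=> h.
      by rewrite pl /GRing.scale/= mulr1.
    by split; [apply/cvg_ex; exists 0|exact: cvg_lim c1].
  - apply: continuous_in_subspaceT => s; rewrite inE/= in_itv/= => s01.
    by apply: pc; exact: cg.
  - move=> c _; rewrite mul0r => /eqP; rewrite subr_eq0 /g/= => /eqP.
    by rewrite mul1r mul0r.
apply/eqP; rewrite eq_complex; apply/andP; split; apply/eqP.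
  apply: key; first exact: @cvg_Re.
  by move=> [a b] [c d] e /=; rewrite mul0r subr0.
apply: key; first exact: @cvg_Im.
by move=> [a b] [c d] e /=; rewrite mul0r addr0.
Unshelve. all: by end_near.
Qed.
End rotation_invariant.
End complex_limits.

(** * L^p norms of complex functions *)

Section Lp_norm_theory.
Context d (T : measurableType d) (R : realType) (mu : {measure set T -> \bar R}).
Variable p : R.
Hypothesis p0 : 0 < p.
Local Open Scope ereal_scope.
Implicit Types f g : T -> Cplx R.

Definition powp (z : Cplx R) : \bar R := ((normc z) `^ p)%:E.

Lemma powp_ge0 z : 0 <= powp z.
Proof. by rewrite lee_fin powR_ge0. Qed.

Lemma powp0 : powp 0%R = 0.
Proof. by rewrite /powp normc0 powR0// gt_eqF. Qed.

Lemma le_powp (z w : Cplx R) : (normc z <= normc w)%R -> powp z <= powp w.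
Proof.
move=> zw; rewrite lee_fin.
by apply: ge0_ler_powR; rewrite ?nnegrE ?normc_ge0// ltW.
Qed.

Lemma measurable_powp f : measurable_C setT f ->
  measurable_fun setT (fun x => powp (f x)).
Proof.
move=> mf; apply/measurable_EFinP.
exact: (measurableT_comp (@measurable_powR R p) (measurable_normc mf)).
Qed.

Lemma Lp_normE f : Lp_norm mu setT p f = (\int[mu]_x powp (f x)) `^ p^-1.
Proof.
rewrite /Lp_norm unlock; congr (_ `^ _); apply: eq_integral => x _.
rewrite patchT ?inE// gee0_abs ?lee_fin; last exact: normc_ge0.
by rewrite poweR_EFin.
Qed.

Lemma Lp_norm_mkcond D f : Lp_norm mu D p f = Lp_norm mu setT p (f \_ D).
Proof.
rewrite /Lp_norm; apply: eq_Lnorm => x.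
by rewrite [in RHS]patchT ?inE// !patchE; case: ifP => // _; rewrite normc0.
Qed.

Lemma int_powp_ge0 f : 0 <= \int[mu]_x powp (f x).
Proof. by apply: integral_ge0 => x _; exact: powp_ge0. Qed.

Lemma le_root (x y : \bar R) : 0 <= x -> x <= y -> x `^ p^-1 <= y `^ p^-1.
Proof.
move=> x0 xy; apply: gt0_ler_poweR => //; rewrite ?invr_ge0 ?(ltW p0)//.
  by rewrite in_itv/= x0 leey.
by rewrite in_itv/= (le_trans x0)// leey.
Qed.

Lemma le_Lp_norm f g : measurable_C setT f -> measurable_C setT g ->
  (forall x, normc (f x) <= normc (g x))%R ->
  Lp_norm mu setT p f <= Lp_norm mu setT p g.
Proof.
move=> mf mg fg; rewrite !Lp_normE; apply: le_root; first exact: int_powp_ge0.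
apply: ge0_le_integral => //.
- by move=> x _; exact: powp_ge0.
- exact: measurable_powp.
- exact: measurable_powp.
- by move=> x _; exact: le_powp.
Qed.

(** Where the limit is [0] there is nothing to prove, which avoids the
    continuity of [x `^ p] at [0]. *)
Let powp_liminf (u : nat -> Cplx R) (l : Cplx R) :
  normc (u k) @[k --> \oo] --> normc l ->
  powp l <= limn_einf (fun k => powp (u k)).
Proof.
move=> ul; have [->|l0] := eqVneq l 0%R.
  rewrite powp0 limn_einf_lim; apply: lime_ge; first exact: is_cvg_einfs.
  apply: nearW => k; apply: le_ereal_inf_tmp => _ [j _ <-]; exact: powp_ge0.
have cl : powp (u k) @[k --> \oo] --> powp l.
  apply: cvg_EFin; first by apply: nearW => k.
  rewrite /comp/=.
  apply: (@cvg_comp _ _ _ (fun k => normc (u k)) (fun x => x `^ p)%R _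
    (nbhs (normc l))) => //.
  have lpos : normc l \in `]0%R, +oo[ by rewrite in_itv/= normc_gt0.
  have /derivable1_diffP/differentiable_continuous :=
    @derivable_powR R 1%R p _ lpos.
  exact.
by rewrite (cvg_limn_einf_sup cl).1.
Qed.

(** The lower semicontinuity of the [L^p] norm under pointwise convergence of
    moduli, from Fatou's lemma for the [p]-th powers. *)
Lemma Lp_norm_fatou (F : nat -> T -> Cplx R) f (K : \bar R) :
  (forall k, measurable_C setT (F k)) ->
  (forall x, normc (F k x) @[k --> \oo] --> normc (f x)) ->
  measurable_C setT f ->
  (forall k, Lp_norm mu setT p (F k) <= K) -> Lp_norm mu setT p f <= K.
Proof.
move=> mF Ff mf FK.
have K0 : 0 <= K by apply: le_trans (FK 0%N); exact: Lnorm_ge0.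
have pp : p \is a GRing.unit by rewrite unitfE gt_eqF.
have -> : K = (K `^ p) `^ p^-1 by rewrite -poweRrM divrr// poweRe1.
rewrite Lp_normE; apply: le_root; first exact: int_powp_ge0.
apply: (@le_trans _ _ (\int[mu]_x limn_einf (fun k => powp (F k x)))).
  apply: ge0_le_integral => //.
  - by move=> x _; exact: powp_ge0.
  - exact: measurable_powp.
  - rewrite (_ : (fun x => _) = (fun x => - limn_esup (fun k => - powp (F k x)))).
      apply: measurableT_comp => //; apply: measurable_fun_limn_esup => k.
      by apply: measurableT_comp => //; exact: measurable_powp.
    apply/funext => x; rewrite -limn_einfN; congr limn_einf.
    by apply/funext => k; rewrite /= ?opprK.
  - by move=> x _; exact: powp_liminf.
apply: le_trans (fatou _ _ _ _) _ => //.
- by move=> k; exact: measurable_powp.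
- by move=> k x _; exact: powp_ge0.
rewrite limn_einf_lim; apply: lime_le; first exact: is_cvg_einfs.
apply: nearW => k; apply: (@le_trans _ _ (\int[mu]_x powp (F k x))).
  by apply: ereal_inf_lbound; exists k => //=.
have -> : \int[mu]_x powp (F k x) = (Lp_norm mu setT p (F k)) `^ p.
  by rewrite Lp_normE -poweRrM mulVr// poweRe1// int_powp_ge0.
apply: gt0_ler_poweR; rewrite ?(ltW p0)// ?in_itv/= ?leey ?K0//.
by rewrite Lnorm_ge0.
Qed.

End Lp_norm_theory.

Section Lp_norm_change.
Local Open Scope ereal_scope.
Context d1 d2 (X : measurableType d1) (Y : measurableType d2) (R : realType).
Variables (mu : {measure set X -> \bar R}) (nu : {measure set Y -> \bar R}).
Variables (phi : X -> Y) (c : R) (D : set Y).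
Hypothesis c0 : (0 < c)%R.
Hypothesis munu : forall F : Y -> \bar R, measurable_fun setT F ->
  (forall y, 0 <= F y) -> (forall y, ~ D y -> F y = 0) ->
  \int[mu]_x F (phi x) = c%:E * \int[nu]_y F y.

Lemma Lp_norm_change p (k : Y -> Cplx R) : (0 < p)%R -> measurable_C setT k ->
  (forall y, ~ D y -> k y = 0%R) ->
  Lp_norm mu setT p (fun x => k (phi x)) =
  (c `^ p^-1)%:E * Lp_norm nu setT p k.
Proof.
move=> p0 mk k0; rewrite !Lp_normE.
rewrite (munu (F := fun y => powp p (k y))).
- by rewrite poweRM ?lee_fin ?(ltW c0) ?int_powp_ge0// poweR_EFin.
- exact: measurable_powp.
- by move=> y; exact: powp_ge0.
- by move=> y /k0 ->; rewrite powp0.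
Qed.
End Lp_norm_change.

(** * Coordinates on Siegel half-spaces of consecutive dimensions *)

Section geometry.
Context {R : realType}.
Local Notation C := (Cplx R).

(** Prepends a first coordinate; [base] forgets it. The first coordinate is used
    because [lebesgue_Cm] is built by adding coordinates at the head. *)
Definition embed m (a : C) (z : Cpt R m) : Cpt R m.+1 :=
  (row_mx (a%:M : 'M[C]_1) z.1 : 'rV[C]_(1 + m), z.2).

Definition base m (z : Cpt R m.+1) : Cpt R m :=
  (rsubmx (z.1 : 'rV[C]_(1 + m)), z.2).

Lemma embedK m a : cancel (@embed m a) (@base m).
Proof. by case=> w s; rewrite /base /embed/= row_mxKr. Qed.

Lemma embed_head m a (z : Cpt R m) :
  ((embed a z).1 : 'rV_(1 + m)) 0 (lshift m ord0) = a.
Proof. by rewrite [LHS]row_mxEl mxE eqxx mulr1n. Qed.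

Lemma embed_tail m a (z : Cpt R m) i :
  ((embed a z).1 : 'rV_(1 + m)) 0 (rshift 1 i) = z.1 0 i.
Proof. exact: row_mxEr. Qed.

(** The kernels in consecutive dimensions; at [a = 0] the term in the first
    coordinate disappears. *)
Lemma rho_embed m a b (z w : Cpt R m) :
  rho (embed a z) (embed b w) = rho z w - a * b^*%C.
Proof.
rewrite /rho /hdot -addrA; congr (_ + _).
rewrite -opprD; congr (- _).
rewrite (@big_split_ord _ _ _ 1 m) big_ord1 addrC !embed_head; congr (_ + _).
by apply: eq_bigr => i _; rewrite !embed_tail.
Qed.

Lemma sqnorm_embed m a (z : Cpt R m) :
  sqnorm (embed a z).1 = normc a ^+ 2 + sqnorm z.1.
Proof.
rewrite /sqnorm (@big_split_ord _ _ _ 1 m) big_ord1 embed_head; congr (_ + _).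
by apply: eq_bigr => i _; rewrite embed_tail.
Qed.

Lemma embedE m a (z : Cpt R m) : embed a z = a *: embed 1 0 + embed 0 z.
Proof.
rewrite /embed; congr pair; last by rewrite /= scaler0 add0r.
rewrite /= -[RHS]/(a *: row_mx 1%:M 0 + row_mx 0%:M z.1).
rewrite scale_row_mx add_row_mx scaler0 add0r scale_scalar_mx mulr1.
by rewrite -raddfD addr0.
Qed.

(** [embed] is affine in its first argument, with direction [embed 1 0]. *)
Lemma derivable_embed m (S : Cpt R m.+1 -> C) b (z : Cpt R m) :
  derivable S (embed b z) (embed 1 0) -> derivable (fun c => S (embed c z)) b 1.
Proof.
rewrite /derivable => dS.
rewrite (_ : (fun h => _) = (fun h : C =>
  h^-1 *: ((S \o shift (embed b z)) (h *: embed 1 0) - S (embed b z))))//.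
apply/funext => h; rewrite /shift/=; congr (_ *: (S _ - _)).
by rewrite embedE [embed b z]embedE addrA -scalerDl [_ *: 1]mulr1.
Qed.

Lemma bdry_ptE m (x : mplane R m.+1 * measurableTypeR R) :
  bdry_pt x = embed (toC (puncons x.1).1) (vol_pt (drop_bdry x)).
Proof.
congr pair; apply/rowP => j; rewrite !mxE.
case: splitP => k jk.
  rewrite ord1 mxE eqxx mulr1n /thead; congr (toC (tnth _ _)).
  by apply: val_inj; rewrite /= jk ord1.
rewrite mxE; rewrite (_ : j = lift ord0 k); last by apply: val_inj.
by rewrite [in LHS](tuple_eta x.1) tnthS.
Qed.

Lemma vol_pt_surj m (z : Cpt R m) : exists y, vol_pt y = z.
Proof.
pose c (a : C) : plane R := (complex.Re a, complex.Im a).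
have cK a : toC (c a) = a by case: a.
exists ([tuple c (z.1 0 j) | j < m], c z.2).
rewrite [RHS]surjective_pairing /vol_pt/= cK; congr pair.
by apply/rowP => j; rewrite mxE tnth_mktuple cK.
Qed.

(** The translation by [t i] in the coordinates of [vol_pt]. *)
Definition vert m (t : R) (y : mplane R m * plane R) : mplane R m * plane R :=
  (y.1, (y.2.1, y.2.2 + t)).

Lemma measurable_vert m t : measurable_fun setT (@vert m t).
Proof.
apply: measurable_fun_pair => //=.
have m2 : measurable_fun setT (fun y : mplane R m * plane R => y.2.2).
  exact: (measurableT_comp measurable_snd measurable_snd).
apply: measurable_fun_pair => //=.
  exact: (measurableT_comp measurable_fst measurable_snd).
exact: measurable_funD.
Qed.

Lemma vol_pt_vert m t (y : mplane R m * plane R) :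
  vol_pt (vert t y) = vol_pt y + t%:C%C *: ibold m.
Proof.
rewrite /vol_pt /ibold /vert; congr pair; first by rewrite /= scaler0 addr0.
apply/eqP; rewrite eq_complex/=.
by rewrite !(mul0r, mulr0, mulr1, subr0, addr0, add0r) !eqxx.
Qed.

Lemma embed_vert m a t (z : Cpt R m) :
  embed a z + t%:C%C *: ibold m.+1 = embed a (z + t%:C%C *: ibold m).
Proof.
by rewrite /embed /ibold; congr pair; rewrite /= !scaler0 !addr0.
Qed.

Lemma measurable_vol_siegel m :
  measurable (vol_siegel m : set (mplane R m * plane R)).
Proof.
pose h (y : mplane R m * plane R) : measurableTypeR R := sqnorm (toCm y.1) - y.2.2.
have mh : measurable_fun setT h.
  apply: measurable_funB.
    exact: (measurableT_comp (@measurable_sqnorm R m) measurable_fst).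
  exact: (measurableT_comp measurable_snd measurable_snd).
rewrite (_ : vol_siegel m = setT `&` h @^-1` `]-oo, 0%R[%classic).
  exact: mh.
rewrite setTI; apply/seteqP; split => y /=;
  by rewrite /vol_siegel /siegel/= in_itv/= subr_lt0.
Qed.

Lemma differentiable_embed0 m (z : Cpt R m) : differentiable (@embed m 0) z.
Proof.
have c0 : continuous (mulmxr (row_mx 0 1%:M : 'M[C]_(m, 1 + m)) :
    'rV[C]_m -> 'rV[C]_(1 + m)).
  move=> u A /nbhs_ballP[e /= e0 eA].
  suff H : nbhs u ((fun x => x *m (row_mx 0 1%:M : 'M[C]_(m, 1 + m))) @^-1` A).
    exact: H.
  apply/(@nbhs_ballP _ 'rV[C]_m u).
  exists e => //= v [_ uv]; apply: eA; split => // i j.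
  rewrite !mul_mx_row !mulmx1 !mulmx0 ord1.
  case: (splitP j) => k jk.
    rewrite (_ : j = lshift m k); last exact: val_inj.
    by rewrite !row_mxEl mxE /ball/= subrr normr0.
  rewrite (_ : j = rshift 1 k); last exact: val_inj.
  by rewrite !row_mxEr; have := uv 0 k.
have -> : @embed m 0 =
    fun z => (mulmxr (row_mx 0 1%:M : 'M[C]_(m, 1 + m)) z.1, z.2).
  apply/funext => -[w s]; rewrite /embed/=; congr pair.
  by rewrite mul_mx_row mulmx1 mulmx0 raddf0.
have dfst : differentiable (fst : Cpt R m -> 'rV[C]_m) z.
  by apply: linear_differentiable => x; exact: cvg_fst.
have dsnd : differentiable (snd : Cpt R m -> C) z.
  by apply: linear_differentiable => x; exact: cvg_snd.
apply: differentiable_pair; last exact: dsnd.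
apply: (differentiable_comp dfst).
exact: linear_differentiable.
Qed.
End geometry.

(** * Lifting functions from the half-space to the higher boundary *)

Lemma integral_C_rot_bdry (R : realType) m a
    (k : mplane R m.+1 * measurableTypeR R -> Cplx R) : measurable_C setT k ->
  integral_C (beta m.+1) setT (fun x => k (rot_bdry a x)) =
  integral_C (beta m.+1) setT k.
Proof.
move=> mk; rewrite -[RHS]mul1r; apply: (integral_C_change (D := setT)) => //.
  by move=> F mF F0 _; rewrite mul1e; exact: ge0_integral_rot_bdry.
by move=> y [].
Qed.

Lemma differentiable_vert_cvg (R : realType) m (F : Cpt R m -> Cplx R) z :
  differentiable F z ->
  normc (F (z + (k.+1%:R^-1)%:C%C *: ibold m)) @[k --> \oo] --> normc (F z).
Proof.
move=> /differentiable_continuous Fc.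
have t0 : ((k.+1%:R^-1 : R)%:C%C : Cplx R) @[k --> \oo] --> (0 : Cplx R).
  apply/cvgC_normcP => e e0; near=> k.
  rewrite sub0r normcN /= expr0n addr0 sqrtr_sqr.
  near: k.
  exact: (@cvgr0_norm_lt _ R^o _ _ _ _ (@cvg_harmonic R)).
have zc : z + ((k.+1%:R^-1 : R)%:C%C : Cplx R) *: ibold m @[k --> \oo] --> z.
  rewrite -[X in _ --> X]addr0 -[X in z + X](scale0r (ibold m)).
  by apply: cvgD; [exact: cvg_cst|apply: cvgZl].
have /cvgC_normcP Fz := cvg_comp _ _ zc Fc.
apply/cvgrPdist_lt => e e0; move: (Fz e e0); apply: filterS => k.
apply: le_lt_trans; exact: normc_dist.
Unshelve. all: by end_near.
Qed.

Lemma norm_LpU_mkcond (R : realType) m p (h : Cpt R m -> Cplx R) :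
  norm_LpU p h =
  Lp_norm (volume m) setT p ((fun y => h (vol_pt y)) \_ (vol_siegel m)).
Proof. by rewrite /norm_LpU Lp_norm_mkcond. Qed.

(** The half-space norm is controlled by the norms of the translates by [t i],
    the quantities that appear in the [H^p] norm. *)
Lemma norm_LpU_le_vert (R : realType) m (p : R) (F : Cpt R m -> Cplx R)
    (K : \bar R) :
  0 < p -> measurable_C setT (fun y => F (vol_pt y)) ->
  holomorphic_on (siegel m) F ->
  (forall t, 0 < t -> (Lp_norm (volume m) setT p
     ((fun y => F (vol_pt (vert t y))) \_ (vol_siegel m)) <= K)%E) ->
  (norm_LpU p F <= K)%E.
Proof.
move=> p0 mF hF FK; rewrite norm_LpU_mkcond.
have mD := @measurable_vol_siegel R m.
have mBr (B : mplane R m * plane R -> Cplx R) : measurable_C setT B ->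
    measurable_C setT (B \_ (vol_siegel m)).
  by move=> mB; apply: measurable_C_restrict mD _; exact: measurable_C_funTS.
apply: (@Lp_norm_fatou _ _ _ _ p p0
  (fun k => (fun y => F (vol_pt (vert (k.+1%:R^-1) y))) \_ (vol_siegel m))).
- move=> k; apply: mBr.
  exact: (measurable_C_comp (@measurable_vert R m _) mF).
- move=> y; have [yD|yD] := boolP (y \in vol_siegel m).
    rewrite patchT//.
    rewrite (_ : (fun k => _) =
        fun k => normc (F (vol_pt y + (k.+1%:R^-1)%:C%C *: ibold m))).
      by apply: differentiable_vert_cvg; apply: hF; rewrite inE in yD.
    by apply/funext => k; rewrite patchT// vol_pt_vert.
  rewrite patchN// (_ : (fun k => _) = cst (normc 0)); first exact: cvg_cst.
  by apply/funext => k; rewrite patchN.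
- exact: mBr.
- by move=> k; apply: FK; rewrite invr_gt0.
Qed.

Section lift.
Context {R : realType} (m : nat) (p : R).
Hypothesis p0 : 0 < p.
Local Notation C := (Cplx R).
Variable g : Cpt R m -> C.
Hypothesis gp : LpU m p g.

Let D : set (mplane R m * plane R) := vol_siegel m.
Let G : mplane R m * plane R -> C := (g \o @vol_pt R m) \_ D.

Let mG : measurable_C setT G.
Proof.
by apply: measurable_C_restrict; [exact: measurable_vol_siegel|exact: gp.1].
Qed.

Let G_out y : ~ D y -> G y = 0.
Proof. by move=> Dy; rewrite /G patchN// notin_setE. Qed.

(** The values of [g] outside [siegel m] are arbitrary; cutting them off keeps the
    lift measurable at the boundary points whose first coordinate is [0]. *)
Definition bdry_lift (z : Cpt R m.+1) : C :=
  if `[< siegel m (base z) >] then g (base z) else 0.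

Lemma bdry_liftE x : bdry_lift (bdry_pt x) = G (drop_bdry x).
Proof.
by rewrite /bdry_lift bdry_ptE embedK /G patchE; congr (if _ then _ else _).
Qed.

Lemma Lp_norm_drop (k : mplane R m * plane R -> C) : measurable_C setT k ->
  Lp_norm (beta m.+1) setT p (fun x => (k \_ D) (drop_bdry x)) =
  ((pi `^ p^-1)%:E * Lp_norm (volume m) setT p (k \_ D))%E.
Proof.
move=> mk; apply: (@Lp_norm_change _ _ _ _ _ _ _ _ _ D) => //.
- exact: pi_gt0.
- by move=> F mF F0 FD; exact: ge0_integral_drop_bdry.
- apply: measurable_C_restrict; first exact: measurable_vol_siegel.
  exact: measurable_C_funTS.
- by move=> y Dy; rewrite patchN// notin_setE.
Qed.

Lemma norm_bdry_lift :
  norm_LpbU p bdry_lift = ((pi `^ p^-1)%:E * norm_LpU p g)%E.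
Proof.
rewrite norm_LpU_mkcond -/G /norm_LpbU.
rewrite (_ : bdry_lift \o _ = fun x => G (drop_bdry x)); last first.
  by apply/funext => x; exact: bdry_liftE.
apply: (@Lp_norm_change _ _ _ _ _ _ _ _ _ D) => //; first exact: pi_gt0.
by move=> F mF F0 FD; exact: ge0_integral_drop_bdry.
Qed.

Lemma LpbU_bdry_lift : LpbU m.+1 p bdry_lift.
Proof.
split.
  rewrite (_ : bdry_lift \o _ = fun x => G (drop_bdry x)); last first.
    by apply/funext => x; exact: bdry_liftE.
  apply: measurable_C_comp mG; exact: measurable_drop_bdry.
rewrite -[X in (X < _)%E]/(norm_LpbU p bdry_lift) norm_bdry_lift lte_mul_pinfty//.
  by rewrite lee_fin powR_ge0.
exact: gp.2.
Qed.

Lemma measurable_szego_kernel (z : Cpt R m.+1) : measurable_C setT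
  (fun x => rho z (bdry_pt x) ^- m.+2 * bdry_lift (bdry_pt x)).
Proof.
have [y <-] := vol_pt_surj z.
apply: measurable_CM.
  apply: measurable_CV; apply: measurable_CX.
  pose b (x : mplane R m.+1 * measurableTypeR R) : mplane R m.+1 * plane R :=
    (x.1, (x.2, sqnorm (toCm x.1))).
  have mb : measurable_fun setT b.
    apply: measurable_fun_pair => //; apply: measurable_fun_pair => //.
    exact: (measurableT_comp (@measurable_sqnorm R m.+1) measurable_fst).
  exact: (@measurable_C_rho _ _ _ _ (fun=> y) b (measurable_cst _) mb).
rewrite (_ : (fun x => _) = fun x => G (drop_bdry x)); last first.
  by apply/funext => x; exact: bdry_liftE.
apply: measurable_C_comp mG; exact: measurable_drop_bdry.
Qed.

Lemma measurable_bergman_kernel : measurable_C setT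
  (fun xy : (mplane R m * plane R) * (mplane R m * plane R) =>
    rho (vol_pt xy.1) (vol_pt xy.2) ^- m.+2 * G xy.2).
Proof.
apply: measurable_CM; last by apply: measurable_C_comp mG; exact: measurable_snd.
apply: measurable_CV; apply: measurable_CX.
exact: (measurable_C_rho measurable_fst measurable_snd).
Qed.

Lemma bergmanE z : bergman m g z = ((m.+1)`!%:R / (4 * pi ^+ m.+1))%:C%C *
  integral_C (volume m) setT (fun y => rho z (vol_pt y) ^- m.+2 * G y).
Proof.
rewrite /bergman integral_C_mkcond; congr (_ * integral_C _ _ _).
by apply/funext => y; rewrite /G !patchE; case: ifP => // _; rewrite mulr0.
Qed.

Lemma measurable_bergman : measurable_C setT (fun y => bergman m g (vol_pt y)).
Proof.
rewrite (_ : (fun y => _) = fun y => ((m.+1)`!%:R / (4 * pi ^+ m.+1))%:C%C *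
  integral_C (volume m) setT (fun w => rho (vol_pt y) (vol_pt w) ^- m.+2 * G w)).
  apply: measurable_CM; first exact: measurable_C_cst.
  exact: (measurable_C_integral_volume measurable_bergman_kernel).
by apply/funext => y; rewrite bergmanE.
Qed.

(** The push-forward formula applied to the kernel; its factor [pi] turns the
    Szego constant into the Bergman one. *)
Lemma szego_embed0 z : szego m.+1 bdry_lift (embed 0 z) = bergman m g z.
Proof.
rewrite bergmanE /szego.
pose k y := rho z (vol_pt y) ^- m.+2 * G y.
have mk : measurable_C setT k.
  rewrite /k; have [y <-] := vol_pt_surj z.
  exact: (measurable_C_comp (@measurable_pair1 _ _ _ _ y)
    measurable_bergman_kernel).
rewrite (_ : (fun x => _) = fun x => k (drop_bdry x)); last first.
  by apply/funext => x; rewrite bdry_liftE bdry_ptE rho_embed mul0r subr0.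
rewrite (@integral_C_change _ _ _ _ _ _ (volume m) _ pi D)//.
- have cancel_q (q A : R) : 0 < q ->
      A / (4 * q ^+ m.+2) * q = A / (4 * q ^+ m.+1).
    move=> q0; rewrite exprS; field.
    by rewrite !gt_eqF// exprn_gt0.
  by rewrite mulrA -rmorphM/= cancel_q// pi_gt0.
- exact: pi_gt0.
- by move=> F mF F0 FD; exact: ge0_integral_drop_bdry.
- by move=> y Dy; rewrite /k G_out// mulr0.
Qed.

(** Rotating the pole and the boundary point together changes neither the kernel
    nor the lift, and [dbeta] is invariant. *)
Lemma szego_rotation a c z :
  szego m.+1 bdry_lift (embed (unit_rotation a * c) z) =
  szego m.+1 bdry_lift (embed c z).
Proof.
have kE := integral_C_rot_bdry a
  (measurable_szego_kernel (embed (unit_rotation a * c) z)).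
rewrite /szego; apply: congr1; apply: (etrans (esym kE)).
congr (integral_C _ _ _); apply/funext => x; rewrite !bdry_liftE !bdry_ptE.
have [u [w [t ->]]] := bdry_coords x.
rewrite rot_bdryE !drop_bdryE !pconsK/= !rho_embed sqmod_rotation toC_rotation.
by rewrite rmorphM/= mulrACA unit_rotation_unitary mul1r.
Qed.

Hypothesis holo : holomorphic_on (siegel m.+1) (szego m.+1 bdry_lift).

Lemma szego_embed c z : normc c ^+ 2 + sqnorm z.1 < complex.Im z.2 ->
  szego m.+1 bdry_lift (embed c z) = bergman m g z.
Proof.
move=> cz; rewrite -szego_embed0.
apply: (@rotation_invariant_cst R (fun c => szego m.+1 bdry_lift (embed c z))
  (complex.Im z.2 - sqnorm z.1)); last by rewrite ltrBrDr.
- move=> b; rewrite ltrBrDr => bz.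
  have /diff_derivable : differentiable (szego m.+1 bdry_lift) (embed b z).
    by apply: holo; rewrite /siegel/= sqnorm_embed.
  by move=> /(_ (embed 1 0)); exact: derivable_embed.
- by move=> a b; exact: szego_rotation.
Qed.

Lemma holomorphic_bergman : holomorphic_on (siegel m) (bergman m g).
Proof.
move=> z zU.
rewrite (_ : bergman m g = szego m.+1 bdry_lift \o embed 0); last first.
  by apply/funext => w; rewrite /= szego_embed0.
apply: differentiable_comp; first exact: differentiable_embed0.
apply: holo; rewrite /siegel/= sqnorm_embed.
by rewrite (_ : normc 0 = 0) ?expr0n ?add0r//; exact: normc0.
Qed.

(** Only an inequality: the restriction to [D] discards the boundary points with
    first coordinate [0], which lie over the boundary of [U^m]. *)
Lemma Lp_norm_bergman_vert (t : R) : 0 < t ->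
  ((pi `^ p^-1)%:E * Lp_norm (volume m) setT p
     ((fun y => bergman m g (vol_pt (vert t y))) \_ D) <=
   norm_Hp p (szego m.+1 bdry_lift))%E.
Proof.
move=> t0.
have mB : measurable_C setT (fun y => bergman m g (vol_pt (vert t y))).
  exact: (measurable_C_comp (@measurable_vert R m t) measurable_bergman).
rewrite -(Lp_norm_drop mB).
apply: (@le_trans _ _
  (norm_LpbU p (fun u => szego m.+1 bdry_lift (u + t%:C%C *: ibold m.+1))));
  last first.
  by apply: ereal_sup_ubound; exists t.
rewrite /norm_LpbU.
rewrite (_ : _ \o _ = fun x => bergman m g (vol_pt (vert t (drop_bdry x))));
  last first.
  apply/funext => x; rewrite /= bdry_ptE embed_vert -vol_pt_vert szego_embed//.
  have [u [w [s ->]]] := bdry_coords x.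
  rewrite drop_bdryE pconsK /= sqr_sqrtr; last exact: sqmod_ge0.
  by rewrite ltrDl.
apply: le_Lp_norm => //.
- apply: (measurable_C_comp (@measurable_drop_bdry R m)).
  apply: measurable_C_restrict; first exact: measurable_vol_siegel.
  exact: measurable_C_funTS.
- exact: (measurable_C_comp (@measurable_drop_bdry R m) mB).
- by move=> x; rewrite patchE; case: ifP => // _; rewrite normc0 normc_ge0.
Qed.

Lemma norm_bergman_le (M : R) : 0 <= M ->
  (norm_Hp p (szego m.+1 bdry_lift) <= M%:E * norm_LpbU p bdry_lift)%E ->
  (norm_LpU p (bergman m g) <= M%:E * norm_LpU p g)%E.
Proof.
move=> M0; rewrite norm_bdry_lift muleCA => HM.
apply: (norm_LpU_le_vert p0 measurable_bergman) => [z|t t0].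
  exact: holomorphic_bergman.
have := le_trans (Lp_norm_bergman_vert t0) HM.
by rewrite lee_pmul2l// lte_fin powR_gt0// pi_gt0.
Qed.

End lift.

Theorem theorem5 (R : realType) (n : nat) (p : R) :
  (1 <= n)%N -> (1 < p)%R ->
  (op_norm (LpbU n p) (norm_LpbU p) (Hp n p) (norm_Hp p) (szego n)
   >= op_norm (LpU n.-1 p) (norm_LpU p) (Ap n.-1 p) (norm_LpU p)
        (bergman n.-1))%E.
Proof.
case: n => // m _ p1 /=; have p0 : 0 < p by exact: lt_trans p1.
apply: ereal_inf_le_tmp => _ [M [M0 HM] <-].
exists M; last by [].
split; first exact: M0.
move=> g gp.
have [[holo _] HpM] := HM _ (LpbU_bdry_lift p0 gp).
have gM := norm_bergman_le p0 gp holo M0 HpM.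
split; last exact: gM.
split; last exact: (holomorphic_bergman gp holo).
split; first exact: measurable_C_funTS (measurable_bergman gp).
apply: le_lt_trans gM _; rewrite lte_mul_pinfty//.
exact: gp.2.
Qed.
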